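(* Let $E$ and $F$ be infinite dimensional $\mathscr{L}_1$-spaces. The following assertions are equivalent: (a) $E\widehat{\otimes}_\epsilon F$ has the Dunford-Pettis property; (b) $E\widehat{\otimes}_\epsilon F$ has the Schur property; (c) both $E$ and $F$ have the Schur property.
   Context: $E\widehat{\otimes}_\epsilon F$ is the (completed) injective tensor product of $E$ and $F$. The Banach-Mazur distance between isomorphic Banach spaces is $d(E,F)=\inf \|T\|\|T^{-1}\|$, the infimum being over all isomorphisms $T$ from $E$ onto $F$. A Banach space $E$ is an $\mathscr{L}_1$-space if there is $\lambda\geq 1$ such that every finite dimensional subspace of $E$ is contained in another subspace $N$ of $E$ with $d(N,\ell_1^n)\leq\lambda$ for some integer $n$. An operator (bounded linear map) is completely continuous if it takes weak Cauchy sequences into norm Cauchy sequences. A Banach space $E$ has the Dunford-Pettis property if every weakly compact operator from $E$ into any Banach space is completely continuous; equivalently, $\lim_n\phi_n(x_n)=0$ for all weakly null sequences $(x_n)\subset E$ and $(\phi_n)\subset E^*$. A Banach space has the Schur property if every weakly convergent sequence in it converges in norm. *)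

(* Defs.v *)
From HB Require Import structures.
From mathcomp Require Import all_boot all_order all_algebra.
From mathcomp Require Import complex lra.
From mathcomp Require Import all_classical all_reals.
From mathcomp Require Import topology normedtype.

Set Implicit Arguments.
Unset Strict Implicit.
Unset Printing Implicit Defensive.

Import Order.TTheory GRing.Theory Num.Theory.
Import numFieldNormedType.Exports.

Local Open Scope classical_set_scope.
Local Open Scope ring_scope.

Variant scalar_kind := RealScalars | ComplexScalars.

(* Banach spaces are over the real or the complex field. *)
Definition scalars (R : realType) (k : scalar_kind) : numFieldType :=
  match k with RealScalars => R | ComplexScalars => R[i] end.

Section GeneralNotions.
Variable K : numFieldType.

Definition finite_dimensional (V : lmodType K) :=
  exists (n : nat) (e : 'I_n -> V),
    forall x, exists a : 'I_n -> K, x = \sum_(i < n) a i *: e i.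

Definition dual (E : normedModType K) :=
  {phi : {linear E -> K^o} | continuous phi}.

Definition evaluation (E : normedModType K) (x : E) :
  prod_topology (fun _ : dual E => K^o) := fun phi => sval phi x.

(* [E] with its weak topology and uniformity: the initial ones for the
   evaluation map into a product of copies of the scalar field. *)
Definition weak (E : normedModType K) := initial_topology (@evaluation E).

HB.instance Definition _ (E : normedModType K) := Uniform.on (weak E).

Definition schur (E : normedModType K) :=
  forall (x : nat -> E) (l : E),
    (x : nat -> weak E) @ \oo --> (l : weak E) -> cvgn x.

Definition completely_continuous (E F : normedModType K) (T : E -> F) :=
  forall x : nat -> E,
    cauchy ((x : nat -> weak E) @ \oo) -> cauchy ((T \o x) @ \oo).

Definition weakly_compact (E F : normedModType K) (T : E -> F) :=
  compact (closure ((T @` [set x | `|x| <= 1]) : set (weak F))).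

Definition dunford_pettis (E : normedModType K) :=
  forall (F : completeNormedModType K) (T : {linear E -> F}),
    continuous T -> weakly_compact T -> completely_continuous T.

(* Norms have values in [K], so suprema and infima are taken in [K]; the order
   of the complex field only compares numbers with equal imaginary parts, so
   those of bounded nonempty sets of nonnegative numbers are the real ones. *)
Definition operator_norm (E F : normedModType K) (T : E -> F) : K :=
  supremum 0 [set `|T x| | x in [set x | `|x| <= 1]].

Definition isomorphism (E F : normedModType K)
    (T : {linear E -> F}) (S : {linear F -> E}) :=
  [/\ continuous T, continuous S, cancel T S & cancel S T].

Definition isomorphic (E F : normedModType K) :=
  exists (T : {linear E -> F}) (S : {linear F -> E}), isomorphism T S.

(* Meaningful for isomorphic spaces only: otherwise the set is empty. *)
Definition banach_mazur_distance (E F : normedModType K) : K :=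
  infimum 0 [set d | exists (T : {linear E -> F}) (S : {linear F -> E}),
    isomorphism T S /\ d = operator_norm T * operator_norm S].

End GeneralNotions.

Section Ell1.
Variables (K : numFieldType) (n : nat).

(* An alias, because row vectors already carry the sup norm. *)
Definition ell1 := 'rV[K]_n.

HB.instance Definition _ := GRing.Lmodule.on ell1.

Definition ell1_norm (x : ell1) : K := \sum_(i < n) `|x ord0 i|.

Lemma ler_ell1_normD x y : ell1_norm (x + y) <= ell1_norm x + ell1_norm y.
Proof.
rewrite /ell1_norm -big_split/=; apply: ler_sum => i _.
by rewrite mxE ler_normD.
Qed.

Lemma ell1_normZ (l : K) x : ell1_norm (l *: x) = `|l| * ell1_norm x.
Proof.
by rewrite /ell1_norm mulr_sumr; apply: eq_bigr => i _; rewrite mxE normrM.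
Qed.

Lemma ell1_norm0_eq0 x : ell1_norm x = 0 -> x = 0.
Proof.
move=> /eqP; rewrite psumr_eq0 => [/allP x0|//].
apply/rowP => i; rewrite mxE; apply/eqP; rewrite -normr_eq0.
by apply: x0; rewrite mem_index_enum.
Qed.

HB.instance Definition _ := Lmodule_isNormed.Build K ell1
  ler_ell1_normD ell1_normZ ell1_norm0_eq0.

End Ell1.

Record subspace_of (K : numFieldType) (E : normedModType K) := SubspaceOf {
  subspace_pred :> {pred E};
  subspace_closed : submod_closed subspace_pred }.

HB.instance Definition _ (K : numFieldType) (E : normedModType K)
    (N : subspace_of E) :=
  GRing.isSubmodClosed.Build K E (subspace_pred N) (subspace_closed N).

Record subspace_elt (K : numFieldType) (E : normedModType K)
  (N : subspace_of E) := SubspaceElt {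
  subspace_val : E;
  subspace_valP : subspace_val \in subspace_pred N }.

Section SubspaceNorm.
Variables (K : numFieldType) (E : normedModType K) (N : subspace_of E).
Local Notation V := (subspace_elt N).

HB.instance Definition _ := [isSub for @subspace_val K E N].
HB.instance Definition _ := [Choice of V by <:].
HB.instance Definition _ := [SubChoice_isSubLmodule of V by <:].

Definition subspace_norm (x : V) : K := `|val x|.

Lemma ler_subspace_normD x y :
  subspace_norm (x + y) <= subspace_norm x + subspace_norm y.
Proof. exact: ler_normD. Qed.

Lemma subspace_normZ (l : K) x :
  subspace_norm (l *: x) = `|l| * subspace_norm x.
Proof. exact: normrZ. Qed.

Lemma subspace_norm0_eq0 x : subspace_norm x = 0 -> x = 0.
Proof. by move=> /eqP; rewrite normr_eq0 => /eqP x0; exact: val_inj. Qed.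

HB.instance Definition _ := Lmodule_isNormed.Build K V
  ler_subspace_normD subspace_normZ subspace_norm0_eq0.

End SubspaceNorm.

Definition script_L1_space (K : numFieldType) (E : normedModType K) :=
  exists2 lambda : K, 1 <= lambda &
    forall M : subspace_of E, finite_dimensional (subspace_elt M) ->
      exists (N : subspace_of E) (n : nat),
        [/\ {subset M <= N},
            isomorphic (subspace_elt N) (ell1 K n) &
            banach_mazur_distance (subspace_elt N) (ell1 K n) <= lambda].

Section Scalars.
Variables (R : realType) (k : scalar_kind).
Local Notation K := (scalars R k).

Lemma scalars_supremumP (A : set K) (m : K) :
  A !=set0 -> (forall x, A x -> 0 <= x) -> ubound A m ->
  supremums A (supremum 0 A).
Proof.
move=> [x0 Ax0] A_ge0 ubm; rewrite /supremum ifF; last first.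
  by apply/negbTE/eqP => A0; move: Ax0; rewrite A0.
suff [s ss] : exists s, supremums A s by apply: (xgetPex _ (ex_intro _ s ss)).
case: k A x0 m Ax0 A_ge0 ubm => /= A x0 m Ax0 A_ge0 ubm.
  exists (sup A); split=> [x Ax|y uby].
    by apply: sup_upper_bound => //; split; [exists x0|exists m].
  by apply: ge_sup; [exists x0|].
pose B := [set complex.Re x | x in A].
have B0 : B !=set0 by exists (complex.Re x0); exists x0.
have supB : has_sup B.
  split=> //; exists (complex.Re m) => _ [x /ubm xm <-]; move: xm.
  by rewrite lecE => /andP[].
exists (sup B)%:C%C; split=> [x Ax|y uby].
  rewrite lecE/= (ger0_Im (A_ge0 _ Ax)) eqxx/=.
  by apply: sup_upper_bound => //; exists x.
have := uby _ Ax0; rewrite lecE (ger0_Im (A_ge0 _ Ax0)) => /andP[/eqP Imy _].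
rewrite lecE/= Imy eqxx/=; apply: ge_sup => // _ [x /uby + <-].
by rewrite lecE => /andP[].
Qed.

Lemma scalars_complete (G : set_system K^o) :
  ProperFilter G -> cauchy G -> cvg G.
Proof.
case: k G => /= G PG.
  exact: R_complete.
move=> /cauchyP G_cauchy.
have ReIm_cauchy (f : R[i] -> R) :
    {morph f : x y / x - y} ->
    (forall z : R[i], `|f z|%:C%C <= `|z|) ->
    cauchy (f @ G).
  move=> fB fle; apply/cauchyP => e e0.
  have [z Gz] := G_cauchy e%:C%C (etrans (ltcR _ _) e0).
  exists (f z); rewrite nbhs_simpl/=.
  apply: filterS Gz => x; rewrite -!ball_normE/= => zx.
  rewrite -ltcR; apply: le_lt_trans zx.
  by have := fle (z - x); rewrite fB.
have Re_le (z : R[i]) : `|complex.Re z|%:C%C <= `|z|.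
  rewrite normc_def lecR -sqrtr_sqr ler_wsqrtr// lerDl sqr_ge0//.
have Im_le (z : R[i]) : `|complex.Im z|%:C%C <= `|z|.
  by rewrite normc_def lecR -sqrtr_sqr ler_wsqrtr// lerDr sqr_ge0.
have ReB : {morph @complex.Re R : x y / x - y} by move=> [? ?] [].
have ImB : {morph @complex.Im R : x y / x - y} by move=> [? ?] [].
have /R_complete/cvg_ex[/= a Ga] := ReIm_cauchy _ ReB Re_le.
have /R_complete/cvg_ex[/= b Gb] := ReIm_cauchy _ ImB Im_le.
apply/cvg_ex; exists (a +i* b)%C.
apply/cvgrPdist_lt => /= e e0.
have eRe : e = (complex.Re e)%:C%C.
  by rewrite [LHS]complexE (ger0_Im (ltW e0)) mulr0 addr0.
have Re0 : 0 < complex.Re e by rewrite -ltcR -eRe.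
have Re20 : 0 < complex.Re e / 2 by rewrite divr_gt0.
near=> z.
have za : `|a - complex.Re z| < complex.Re e / 2.
  by near: z; move/cvgrPdist_lt: Ga; exact.
have zb : `|b - complex.Im z| < complex.Re e / 2.
  by near: z; move/cvgrPdist_lt: Gb; exact.
rewrite eRe normc_def ltcR (_ : complex.Re e = Num.sqrt (complex.Re e ^+ 2)); last first.
  by rewrite sqrtr_sqr gtr0_norm.
rewrite ltr_sqrt ?exprn_gt0//.
rewrite ReB ImB/= -(real_normK (num_real (a - _))).
rewrite -(real_normK (num_real (b - _))).
have := normr_ge0 (a - complex.Re z); have := normr_ge0 (b - complex.Im z).
by nra.
Unshelve. all: by end_near. Qed.

End Scalars.

(* Continuity is implied by the bound. *)
Definition dual_ball (K : numFieldType) (E : normedModType K) :=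
  {phi : {linear E -> K^o} | forall x, `|phi x| <= `|x|}.

(* [u] represents the sum of the elementary tensors of the pairs in [u]; the
   injective norm of this sum is by definition the supremum of the absolute
   value of [tensor_form u] on the product of the dual unit balls. *)
Definition tensor_form (K : numFieldType) (E F : normedModType K)
    (u : seq (E * F)) : dual_ball E * dual_ball F -> K^o :=
  fun p => \sum_(z <- u) sval p.1 z.1 * sval p.2 z.2.

(* So [tensor_form] embeds the algebraic tensor product, with the injective
   norm, isometrically into the bounded functions with the sup norm. The
   completion is the closure of the image: the uniform limits of tensor
   forms. *)
Definition injective_tensor_pred (K : numFieldType) (E F : normedModType K) :
    {pred dual_ball E * dual_ball F -> K^o} :=
  [pred f | `[< forall e : K, 0 < e ->
      exists u, forall p, `|f p - tensor_form u p| <= e >]].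

Record injective_tensor (R : realType) (k : scalar_kind)
    (E F : normedModType (scalars R k)) := InjectiveTensor {
  injective_tensor_val : dual_ball E * dual_ball F -> (scalars R k)^o;
  injective_tensor_valP :
    injective_tensor_val \in @injective_tensor_pred _ E F }.

Section InjectiveTensor.
Variables (R : realType) (k : scalar_kind).
Local Notation K := (scalars R k).
Variables E F : normedModType K.
Local Notation V := (injective_tensor E F).

Lemma injective_tensor_predP (f : dual_ball E * dual_ball F -> K^o) :
  reflect (forall e : K, 0 < e ->
    exists u, forall p, `|f p - tensor_form u p| <= e)
  (f \in @injective_tensor_pred K E F).
Proof. exact: asboolP. Qed.

Lemma tensor_form_cat (u v : seq (E * F)) p :
  tensor_form (u ++ v) p = tensor_form u p + tensor_form v p.
Proof. by rewrite /tensor_form big_cat. Qed.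

Lemma tensor_form_scale (a : K) (u : seq (E * F)) p :
  tensor_form [seq (a *: z.1, z.2) | z <- u] p = a * tensor_form u p.
Proof.
rewrite /tensor_form big_map mulr_sumr; apply: eq_bigr => z _ /=.
by rewrite linearZ/= -mulrA.
Qed.

Lemma injective_tensor_closed : submod_closed (@injective_tensor_pred K E F).
Proof.
split.
  apply/injective_tensor_predP => e e0; exists [::] => p.
  by rewrite /tensor_form big_nil subrr normr0 ltW.
move=> a f g /injective_tensor_predP fP /injective_tensor_predP gP.
apply/injective_tensor_predP => e e0.
have e20 : 0 < e / 2 by rewrite divr_gt0.
have a0 : 0 < `|a| + 1 by rewrite ltr_wpDl.
have [|u uP] := fP (e / 2 / (`|a| + 1)); first by rewrite divr_gt0.
have [v vP] := gP _ e20.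
exists ([seq (a *: z.1, z.2) | z <- u] ++ v) => p.
rewrite tensor_form_cat tensor_form_scale [X in `|X - _|](_ : _ = a * f p + g p)//.
rewrite opprD addrACA -mulrBr (splitr e) (le_trans (ler_normD _ _))//.
rewrite lerD// normrM.
rewrite (@le_trans _ _ ((`|a| + 1) * (e / 2 / (`|a| + 1))))//.
  by rewrite ler_pM// lerDl.
by rewrite mulrC divfK// gt_eqF.
Qed.

HB.instance Definition _ :=
  GRing.isSubmodClosed.Build K (dual_ball E * dual_ball F -> K^o)
    (@injective_tensor_pred K E F) injective_tensor_closed.

HB.instance Definition _ := [isSub for @injective_tensor_val R k E F].
HB.instance Definition _ := [Choice of V by <:].
HB.instance Definition _ := [SubChoice_isSubLmodule of V by <:].

Definition injective_norm (f : V) : K :=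
  supremum 0 [set `|val f p| | p in [set: dual_ball E * dual_ball F]].

Lemma dual_ball0P (G : normedModType K) x :
  `|(\0 : {linear G -> K^o}) x| <= `|x|.
Proof. by rewrite normr0. Qed.

Definition dual_ball0 (G : normedModType K) : dual_ball G :=
  exist _ _ (@dual_ball0P G).

Lemma injective_normP (f : V) :
  supremums [set `|val f p| | p in [set: dual_ball E * dual_ball F]]
    (injective_norm f).
Proof.
have [u uP] := injective_tensor_predP _ (valP f) 1 ltr01.
apply: (@scalars_supremumP R k _ (1 + \sum_(z <- u) `|z.1| * `|z.2|)).
- by exists `|val f (dual_ball0 E, dual_ball0 F)|, (dual_ball0 E, dual_ball0 F).
- by move=> _ [p _ <-].
move=> _ [p _ <-]; rewrite -(subrK (tensor_form u p) (val f p)).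
rewrite (le_trans (ler_normD _ _))// lerD//.
rewrite (le_trans (ler_norm_sum _ _ _))// ler_sum// => z _.
by rewrite normrM ler_pM//; [exact: (svalP p.1)|exact: (svalP p.2)].
Qed.

Lemma ler_injective_norm (f : V) p : `|val f p| <= injective_norm f.
Proof. by apply: (injective_normP f).1; exists p. Qed.

Lemma injective_norm_le (f : V) (c : K) :
  (forall p, `|val f p| <= c) -> injective_norm f <= c.
Proof. by move=> fc; apply: (injective_normP f).2 => _ [p _ <-]. Qed.

Lemma ler_injective_normD f g :
  injective_norm (f + g) <= injective_norm f + injective_norm g.
Proof.
apply: injective_norm_le => p; apply: le_trans (ler_normD _ _) _.
by apply: lerD; exact: ler_injective_norm.
Qed.

Lemma injective_normZ (a : K) f :
  injective_norm (a *: f) = `|a| * injective_norm f.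
Proof.
have le1 b g : injective_norm (b *: g) <= `|b| * injective_norm g.
  apply: injective_norm_le => p; rewrite [`|_|]normrM.
  by apply: ler_wpM2l => //; exact: ler_injective_norm.
apply/eqP; rewrite eq_le le1/=.
have [->|a0] := eqVneq a 0.
  rewrite normr0 mul0r.
  by apply: le_trans (ler_injective_norm _ (dual_ball0 E, dual_ball0 F)).
have := le1 a^-1 (a *: f); rewrite scalerA mulVf// scale1r normfV.
by rewrite -ler_pdivlMl ?invr_gt0 ?normr_gt0// invrK.
Qed.

Lemma injective_norm0_eq0 f : injective_norm f = 0 -> f = 0.
Proof.
move=> f0; apply: val_inj; apply/funext => p; apply/eqP.
by rewrite -normr_le0 -f0; exact: ler_injective_norm.
Qed.

HB.instance Definition _ := Lmodule_isNormed.Build K V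
  ler_injective_normD injective_normZ injective_norm0_eq0.

Lemma injective_tensor_complete (G : set_system V) :
  ProperFilter G -> cauchy G -> cvg G.
Proof.
move=> PG /cauchyP G_cauchy.
have Gp p : cvg ((fun f : V => val f p : K^o) @ G).
  apply: scalars_complete; apply/cauchyP => e e0.
  have [f Gf] := G_cauchy _ e0.
  exists (val f p); rewrite nbhs_simpl/=.
  apply: filterS Gf => g; rewrite -!ball_normE/=.
  exact: le_lt_trans (ler_injective_norm (f - g) p).
pose l p := lim ((fun f : V => val f p : K^o) @ G).
have Gl (e : K) : 0 < e -> \forall f \near G, forall p, `|val f p - l p| <= e.
  move=> e0; have e20 : 0 < e / 2 by rewrite divr_gt0.
  have [h Gh] := G_cauchy _ (divr_gt0 e20 (ltr0n _ 2)).
  apply: filterS (Gh) => f hf p.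
  near G => g.
  have hg : ball h (e / 2 / 2) g by near: g.
  have gl : `|l p - val g p| < e / 2.
    by near: g; move/cvgrPdist_lt: (Gp p); exact.
  have fg : `|f - g| < e / 2.
    move: hf hg; rewrite -!ball_normE/= => hf hg.
    rewrite -(subrKA h) (le_lt_trans (ler_normD _ _))//.
    by rewrite (splitr (e / 2)) ltrD// distrC.
  rewrite -(subrKA (val g p)) (splitr e) (le_trans (ler_normD _ _))// lerD//.
    exact: le_trans (ler_injective_norm (f - g) p) (ltW fg).
  by rewrite distrC ltW.
have lP : l \in @injective_tensor_pred K E F.
  apply/injective_tensor_predP => e e0.
  have e20 : 0 < e / 2 by rewrite divr_gt0.
  near G => f.
  have fl : forall p, `|val f p - l p| <= e / 2 by near: f; exact: Gl.
  have [u uP] := injective_tensor_predP _ (valP f) _ e20.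
  exists u => p; rewrite -(subrKA (val f p)) (splitr e).
  by rewrite (le_trans (ler_normD _ _))// lerD// distrC.
apply/cvg_ex; exists (InjectiveTensor lP).
apply/cvgrPdist_le => e e0; apply: filterS (Gl _ e0) => f fl.
by rewrite distrC; exact: injective_norm_le.
Unshelve. all: by end_near. Qed.

HB.instance Definition _ :=
  Uniform_isComplete.Build V injective_tensor_complete.

End InjectiveTensor.

(* Main.v *)
Require Import Defs.
From HB Require Import structures.
From mathcomp Require Import all_boot all_order all_algebra.
From mathcomp Require Import complex finmap ring lra.
From mathcomp Require Import all_classical all_reals.
From mathcomp Require Import topology normedtype.

Set Implicit Arguments.
Unset Strict Implicit.
Unset Printing Implicit Defensive.

Import Order.TTheory GRing.Theory Num.Theory.
Import numFieldNormedType.Exports.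

Local Open Scope classical_set_scope.
Local Open Scope ring_scope.

(** Write X for the injective tensor product.

    (c) implies (b). Let d_n be weakly null in X, nearly attaining its norm at
    a pair (p_n, q_n) of functionals. Slicing d_n by q_n gives x_n in E, and
    slicing it by a fixed p gives y_n in F. The y_n are weakly null, hence norm
    null, and |p(x_n)| = |q_n(y_n)| <= |y_n|. So the x_n are weakly null, hence
    norm null, while |d_n| <= 2 |x_n| ([schur_tensor]).

    (b) implies (a), since a weak Cauchy sequence of a Schur space is norm
    Cauchy ([schur_dunford_pettis]); (b) implies (c), since tensoring with a
    fixed nonzero vector embeds each factor ([schur_tensor_left]).

    (a) implies (c) is the heart of the matter. If E is not Schur, it contains
    normalized weakly null z_n; let the functionals r_n of the dual ball norm
    them up to a constant. Since F is an infinite-dimensional L1-space, there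
    are q_n in its dual with |q_1(y)| + |q_2(y)| + ... <= |y| for all y, and bounded
    y_n with q_n(y_n) bounded away from 0 ([script_L1_wuc]): the dual of F
    contains c_0. Since E has cotype 2, the operator u |-> (u(r_n, q_n))_n maps X into l2
    ([injective_tensor_square_sum]), so it is weakly compact as an operator into
    the bounded sequences ([l2_weakly_compact]). The tensors of z_n and y_n are
    weakly null in X ([tensor_weakly_null]), but their images have a large n-th
    coordinate: X fails the Dunford-Pettis property ([l2_null_schur]).

    Both uses of the L1 hypothesis go through charts, identifications with a
    finite-dimensional l1 of subspaces that contain a prescribed finite family.
    A choice of bounded coefficients in every chart has a limit along an
    ultrafilter on the finite families, which is a functional on the whole space
    ([chart_limit]); this gives norming functionals. For the q_n, the basis of
    one large chart is looked at in larger charts. All its signed sums are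
    large, so by a second moment computation its vectors carry, on average, a
    fixed mass on pairwise disjoint sets of coordinates ([chart_basis_disjoint]). Picking
    one vector of such a basis at a time, with a set that the previous vectors
    hardly charge, then removing from each set the later ones, gives disjoint
    sets along an infinite sequence, and signs on these sets define the q_n.

    For the weak nullity of tensors, suppose that a functional stays away from
    0 on them. Then no convex combination of the functions |p(z_n)| of p in the
    dual ball is uniformly small. Blackwell's approachability turns this into
    finite averages over the dual ball, hence, in the limit, into a mean under
    which all these functions stay away from 0, against the bounded convergence
    theorem ([bounded_convergence]), the functions being pointwise null and the
    dual ball being compact. *)

(** * Moduli of vectors as real numbers *)

Section Modulus.
Variables (R : realType) (k : scalar_kind).
Local Notation K := (scalars R k).

Definition real_part : K -> R :=
  match k return scalars R k -> R with
  | RealScalars => id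
  | ComplexScalars => @complex.Re R
  end.

Definition of_real : R -> K :=
  match k return R -> scalars R k with
  | RealScalars => id
  | ComplexScalars => fun r => r%:C%C
  end.

Lemma real_part_is_zmod_morphism : zmod_morphism real_part.
Proof. by rewrite /real_part; case: k => //= -[? ?] []. Qed.

HB.instance Definition _ :=
  GRing.isZmodMorphism.Build K R real_part real_part_is_zmod_morphism.

Lemma of_real_is_zmod_morphism : zmod_morphism of_real.
Proof. by rewrite /of_real; case: k => //= a b; rewrite rmorphB. Qed.

Lemma of_real_is_monoid_morphism : monoid_morphism of_real.
Proof.
by rewrite /of_real; case: k => //=; split=> [|a b]; rewrite ?rmorph1 ?rmorphM.
Qed.

HB.instance Definition _ :=
  GRing.isZmodMorphism.Build R K of_real of_real_is_zmod_morphism.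
HB.instance Definition _ :=
  GRing.isMonoidMorphism.Build R K of_real of_real_is_monoid_morphism.

Lemma of_realK : cancel of_real real_part.
Proof. by rewrite /of_real /real_part; case: k. Qed.

Lemma ler_of_real a b : (of_real a <= of_real b) = (a <= b).
Proof. by rewrite /of_real; case: k => //=; rewrite lecR. Qed.

Lemma ltr_of_real a b : (of_real a < of_real b) = (a < b).
Proof. by rewrite /of_real; case: k => //=; rewrite ltcR. Qed.

Lemma real_partK (z : K) : 0 <= z -> of_real (real_part z) = z.
Proof.
rewrite /of_real /real_part; case: k z => //= z z0.
by rewrite [RHS]complexE (ger0_Im z0) mulr0 addr0.
Qed.

Lemma real_partZ a (z : K) : real_part (of_real a * z) = a * real_part z.
Proof.
by rewrite /of_real /real_part; case: k z => //= -[x y] /=; rewrite mul0r subr0.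
Qed.

Section Normed.
Variable V : normedZmodType K.

(** Norms take their values in the scalar field; inequalities between them are
    handled through this real number, uniformly in the kind of scalars. *)
Definition modulus (x : V) : R := real_part `|x|.

Lemma modulusE x : `|x| = of_real (modulus x).
Proof. by rewrite real_partK. Qed.

Lemma modulus_ge0 x : 0 <= modulus x.
Proof. by rewrite -ler_of_real -modulusE rmorph0. Qed.

Lemma modulus0 : modulus 0 = 0.
Proof. by rewrite /modulus normr0 raddf0. Qed.

Lemma modulus_eq0 x : (modulus x == 0) = (x == 0).
Proof.
rewrite -(normr_eq0 x) modulusE; apply/eqP/eqP => [->|]; first by rewrite rmorph0.
by move=> /(congr1 real_part); rewrite of_realK raddf0.
Qed.

Lemma modulus_gt0 x : (0 < modulus x) = (x != 0).
Proof. by rewrite lt_def modulus_eq0 modulus_ge0 andbT. Qed.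

Lemma ler_modulusD x y : modulus (x + y) <= modulus x + modulus y.
Proof. by have := ler_normD x y; rewrite !modulusE -rmorphD ler_of_real. Qed.

Lemma modulusN x : modulus (- x) = modulus x.
Proof. by rewrite /modulus normrN. Qed.

Lemma modulusBC x y : modulus (x - y) = modulus (y - x).
Proof. by rewrite -modulusN opprB. Qed.

Lemma ler_modulusBD x y z : modulus (x - z) <= modulus (x - y) + modulus (y - z).
Proof. by rewrite -(subrKA y); exact: ler_modulusD. Qed.

Lemma lerB_modulus x y : modulus x - modulus y <= modulus (x - y).
Proof. by rewrite lerBlDr -{1}(subrK y x); exact: ler_modulusD. Qed.

Lemma ler_modulus_sum (I : Type) (r : seq I) (P : pred I) (f : I -> V) :
  modulus (\sum_(i <- r | P i) f i) <= \sum_(i <- r | P i) modulus (f i).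
Proof.
elim/big_rec2: _ => [|i u v _ vu]; first by rewrite modulus0.
by apply: le_trans (ler_modulusD _ _) _; rewrite lerD2l.
Qed.

Lemma norm_le_modulus x y : (`|x| <= of_real y) = (modulus x <= y).
Proof. by rewrite modulusE ler_of_real. Qed.

End Normed.

Lemma modulusM (a b : K) : modulus (a * b) = modulus a * modulus b.
Proof. by rewrite {1}/modulus normrM !modulusE -rmorphM of_realK. Qed.

Lemma modulus1 : modulus (1 : K) = 1.
Proof. by rewrite /modulus normr1 -(rmorph1 of_real) of_realK. Qed.

Lemma modulusZ (V : normedModType K) (a : K) (x : V) :
  modulus (a *: x) = modulus a * modulus x.
Proof. by rewrite {1}/modulus normrZ !modulusE -rmorphM of_realK. Qed.

Lemma modulus_of_real (a : R) : 0 <= a -> modulus (of_real a) = a.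
Proof. by move=> a0; rewrite /modulus ger0_norm ?of_realK// -(rmorph0 of_real) ler_of_real. Qed.

Lemma modulus_inv (a : K) : modulus a^-1 = (modulus a)^-1.
Proof.
by rewrite {1}/modulus normfV modulusE -fmorphV of_realK.
Qed.

Definition phase (z : K) : K := if z == 0 then 1 else `|z| / z.

Lemma phaseM z : phase z * z = of_real (modulus z).
Proof.
rewrite /phase; case: eqVneq => [->|z0]; first by rewrite mulr0 modulus0 rmorph0.
by rewrite divfK// modulusE.
Qed.

Lemma modulus_phase z : modulus (phase z) = 1.
Proof.
rewrite /phase; case: eqVneq => [_|z0]; first exact: modulus1.
rewrite modulusM modulus_inv modulusE modulus_of_real ?modulus_ge0//.
by rewrite divff// modulus_eq0.
Qed.

(** The number [c] is the real inner product of the two scalars. This is the only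
    place where moments of signed sums depend on the kind of scalars. *)
Lemma modulus_sqrDB (a b : K) : exists2 c : R, `|c| <= modulus a * modulus b &
  modulus (a + b) ^+ 2 = modulus a ^+ 2 + modulus b ^+ 2 + c *+ 2 /\
  modulus (a - b) ^+ 2 = modulus a ^+ 2 + modulus b ^+ 2 - c *+ 2.
Proof.
rewrite /modulus /real_part; case: k a b => [a b|[a1 a2] [b1 b2]].
  exists (a * b); rewrite ?normrM// !real_normK ?num_real//.
  by split; ring.
exists (a1 * b1 + a2 * b2); rewrite !(congr1 (@complex.Re R) (normc_def _))/=; last first.
  by rewrite !sqr_sqrtr ?addr_ge0 ?sqr_ge0//; split; ring.
rewrite -sqrtrM ?addr_ge0 ?sqr_ge0// -sqrtr_sqr ler_wsqrtr//.
rewrite -subr_ge0 (_ : _ - _ = (a1 * b2 - a2 * b1) ^+ 2) ?sqr_ge0//; ring.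
Qed.

Lemma cvg_modulus (V : normedModType K) (I : Type) (F : set_system I)
    (FF : Filter F) (f : I -> V) (l : V) :
  f @ F --> l <-> forall e : R, 0 < e -> \forall i \near F, modulus (l - f i) < e.
Proof.
split=> [/cvgrPdist_lt fl e e0|fl].
  have := fl (of_real e); rewrite -(rmorph0 of_real) ltr_of_real => /(_ e0).
  by apply: filterS => i; rewrite modulusE ltr_of_real.
apply/cvgrPdist_lt => e e0.
have := fl (real_part e); rewrite -ltr_of_real rmorph0 (real_partK (ltW e0)).
by move=> /(_ e0); apply: filterS => i; rewrite -ltr_of_real -modulusE (real_partK (ltW e0)).
Qed.

End Modulus.

(** * Limits along ultrafilters *)

Section UltraLimits.
Variables (R : realType) (k : scalar_kind) (I : Type) (U : set_system I).
Context {UU : UltraFilter U}.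
Local Notation K := (scalars R k).

(** A cluster point of an ultrafilter is a limit, and intervals are compact. *)
Lemma ultra_real_cvg (f : I -> R) (C : R) :
  (\forall i \near U, `|f i| <= C) -> exists l : R, f @ U --> l.
Proof.
move=> fC.
have FP : ProperFilter (f @ U) by apply: fmap_proper_filter.
have [|l [_ lcl]] := @segment_compact R (- C) C (f @ U) FP.
  by apply: filterS fC => i; rewrite /= in_itv/= ler_norml.
exists l => A Al; have [//|UA] := in_ultra_setVsetC (f @^-1` A) UU.
by have [y []] := lcl (~` A) A UA Al.
Qed.

Lemma ultra_scalar_cvg (f : I -> K) (C : R) :
  (\forall i \near U, modulus (f i) <= C) -> exists l : K^o, (f : I -> K^o) @ U --> l.
Proof.
case: k f => f fC; first exact: ultra_real_cvg fC.
have bnd i : modulus (f i : scalars R ComplexScalars) <= C ->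
    `|complex.Re (f i)| <= C /\ `|complex.Im (f i)| <= C.
  rewrite /modulus /real_part (congr1 (@complex.Re R) (normc_def _))/= => iC.
  by split; apply: le_trans iC; rewrite -sqrtr_sqr ler_wsqrtr// ?lerDl ?lerDr sqr_ge0.
have [|a fa] := @ultra_real_cvg (@complex.Re R \o f) C.
  by apply: filterS fC => i /bnd[].
have [|b fb] := @ultra_real_cvg (@complex.Im R \o f) C.
  by apply: filterS fC => i /bnd[].
exists (a +i* b)%C; apply/(@cvg_modulus R ComplexScalars) => e e0.
have e20 : 0 < e / 2 by rewrite divr_gt0.
move/cvgrPdist_lt: fa => /(_ _ e20) fa; move/cvgrPdist_lt: fb => /(_ _ e20) fb.
near=> i.
have ai : `|a - complex.Re (f i)| < e / 2 by near: i.
have bi : `|b - complex.Im (f i)| < e / 2 by near: i.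
rewrite /modulus /real_part (congr1 (@complex.Re R) (normc_def _))/=.
rewrite [ltRHS](_ : e = Num.sqrt (e ^+ 2)); last by rewrite sqrtr_sqr gtr0_norm.
rewrite ltr_sqrt ?exprn_gt0//; move: ai bi; case: (f i) => c d /= ai bi.
rewrite -(real_normK (num_real (a - _))) -(real_normK (num_real (b - _))).
by have := normr_ge0 (a - c); have := normr_ge0 (b - d); nra.
Unshelve. all: by end_near. Qed.

End UltraLimits.

Section Limits.
Variables (R : realType) (k : scalar_kind).
Local Notation K := (scalars R k).

Lemma modulus_cvg (V : normedModType K) (I : Type) (F : set_system I)
    (FF : Filter F) (f : I -> V) (l : V) :
  f @ F --> l -> (fun i => modulus (f i)) @ F --> modulus l.
Proof.
move=> /cvg_modulus fl; apply/cvgrPdist_lt => e e0; apply: filterS (fl _ e0) => i.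
apply: le_lt_trans; rewrite ler_norml lerB_modulus andbT lerNl opprB modulusBC.
exact: lerB_modulus.
Qed.

Lemma modulus_cvg_le (V : normedModType K) (I : Type) (F : set_system I)
    (FF : ProperFilter F) (f : I -> V) (l : V) (C : R) :
  f @ F --> l -> (\forall i \near F, modulus (f i) <= C) -> modulus l <= C.
Proof. by move=> /modulus_cvg fl; apply: cvgr_to_le fl. Qed.

End Limits.

(** * Functionals and the weak topology *)

Section Functionals.
Variables (R : realType) (k : scalar_kind).
Local Notation K := (scalars R k).
Implicit Types E F : normedModType K.

Lemma modulus_bounded_continuous E F (T : {linear E -> F}) (C : R) :
  (forall x, modulus (T x) <= C * modulus x) -> continuous T.
Proof.
move=> TC; apply: bounded_linear_continuous; apply/linear_boundedP.
near=> r => x; rewrite modulusE (le_trans (_ : _ <= of_real k (C * modulus x)))//.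
  by rewrite ler_of_real.
rewrite rmorphM/= -modulusE ler_wpM2r//; near: r.
by apply: nbhs_pinfty_ge; rewrite realE -(rmorph0 (@of_real R k)) !ler_of_real ge_total.
Unshelve. all: by end_near. Qed.

Lemma continuous_linear_bound E F (T : {linear E -> F}) : continuous T ->
  exists2 C : R, 0 < C & forall x, modulus (T x) <= C * modulus x.
Proof.
move=> /(_ 0)/(continuous_linear_bounded 0)/linear_boundedP.
move=> /pinfty_ex_gt0[M M0 TM]; exists (real_part M).
  by rewrite -(ltr_of_real k) rmorph0 real_partK// ltW.
move=> x; have := TM x; rewrite !modulusE -{1}(real_partK (ltW M0)) -rmorphM.
by rewrite ler_of_real.
Qed.

Lemma in_dual_ball E (phi : {linear E -> K^o}) :
  (forall x, modulus (phi x) <= modulus x) ->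
  exists p : dual_ball E, forall x, sval p x = phi x.
Proof.
move=> phi1.
have pP x : `|phi x| <= `|x| by rewrite !modulusE ler_of_real.
by exists (exist _ phi pP).
Qed.

Lemma modulus_dual_ball E (p : dual_ball E) x : modulus (sval p x) <= modulus x.
Proof. by rewrite -(ler_of_real k) -!modulusE; exact: (svalP p). Qed.

Lemma dual_of_ball E (p : dual_ball E) : exists phi : dual E, sval phi = sval p.
Proof.
suff c : continuous (sval p) by exists (exist _ (sval p) c).
apply: (@modulus_bounded_continuous _ _ _ 1) => x; rewrite mul1r.
exact: modulus_dual_ball.
Qed.

(** Lets statements about all functionals be checked on the dual ball. *)
Lemma dual_scaled_ball E (phi : dual E) : exists (a : K) (p : dual_ball E),
  forall x, sval phi x = a * sval p x.
Proof.
case: phi => phi /= /continuous_linear_bound[C C0 phiC].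
have [|p pP] := @in_dual_ball _ ((of_real k C)^-1 \*: phi).
  move=> x /=; rewrite modulusZ modulus_inv (modulus_of_real _ (ltW C0)).
  by rewrite ler_pdivrMl.
exists (of_real k C), p => x; rewrite pP; apply: esym; apply: (@mulVKf K).
by rewrite -modulus_eq0 modulus_of_real ?gt_eqF ?ltW.
Qed.

Lemma bounded_functional E (f : E -> K^o) (C : R) :
  (forall a x y, f (a *: x + y) = a * f x + f y) ->
  (forall x, modulus (f x) <= C * modulus x) ->
  exists phi : dual E, forall x, sval phi x = f x.
Proof.
move=> flin fC.
have flin' : linear f by [].
pose f' : {linear E -> K^o} := HB.pack f (GRing.isLinear.Build _ _ _ _ f flin').
have c : continuous f' by apply: (@modulus_bounded_continuous _ _ f' C).
by exists (exist _ f' c).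
Qed.

(** Linearity only has to hold eventually, separately for each triple [(a, x, y)]:
    in a limit over charts, [f i] is linear only on the domain of a chart. *)
Lemma ultralimit_functional (I : Type) (U : set_system I) (UU : UltraFilter U) E
    (f : I -> E -> K) (C : R) :
  (forall x, \forall i \near U, modulus (f i x) <= C * modulus x) ->
  (forall a x y, \forall i \near U, f i (a *: x + y) = a * f i x + f i y) ->
  exists phi : {linear E -> K^o},
    (forall x, modulus (phi x) <= C * modulus x) /\
    forall x, (fun i => f i x : K^o) @ U --> phi x.
Proof.
move=> fC flin.
have /choice[phi phiP] x : exists l : K^o, (fun i => f i x : K^o) @ U --> l.
  exact: ultra_scalar_cvg (fC x).
have phi_lin : linear phi.
  move=> a x y; apply: (cvg_unique (@norm_hausdorff _ _)) (phiP _) _.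
  have : (fun i => a *: (f i x : K^o) + f i y) @ U --> a *: phi x + phi y.
    by apply: cvgD => //; apply: cvgZl_tmp.
  apply: cvg_trans; apply: near_eq_cvg; apply: filterS (flin a x y) => i /= ->.
  by [].
pose phi' : {linear E -> K^o} := HB.pack phi (GRing.isLinear.Build _ _ _ _ phi phi_lin).
exists phi'; split=> // x; exact: modulus_cvg_le (phiP x) (fC x).
Qed.

End Functionals.

Lemma initial_cvgP (S : choiceType) (T : topologicalType) (f : S -> T)
    (F : set_system S) (FF : Filter F) (s : S) :
  F --> (s : initial_topology f) <-> f @ F --> f s.
Proof.
split=> [Fs|Fs].
  have := @initial_continuous _ _ f s.
  by apply: cvg_trans; exact: cvg_app.
move=> A /= [_ [[B Bop <-] Bfs sBfA]].
have /Fs : nbhs (f s) B by apply: open_nbhs_nbhs.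
by move=> FB; apply: (@filterS _ F FF _ _ sBfA FB).
Qed.

Section WeakTopology.
Variables (R : realType) (k : scalar_kind).
Local Notation K := (scalars R k).
Variable E : normedModType K.

Lemma weak_cvgP (I : Type) (F : set_system I) (FF : Filter F) (x : I -> E) (l : E) :
  (x : I -> weak E) @ F --> (l : weak E) <->
  forall phi : dual E, (fun i => sval phi (x i)) @ F --> sval phi l.
Proof.
rewrite (@initial_cvgP _ _ (@evaluation K E)) cvg_sup.
split=> + phi => /(_ phi); rewrite initial_cvgP.
  exact.
exact.
Qed.

(** Evaluation at [phi] is uniformly continuous for the product uniformity. *)
Lemma weak_cauchy (x : nat -> E) : cauchy ((x : nat -> weak E) @ \oo) ->
  forall phi : dual E, cauchy ((fun i => sval phi (x i)) @ \oo).
Proof.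
move=> xc phi.
move=> A entA.
have : entourage [set z : weak E * weak E | A (sval phi z.1, sval phi z.2)].
  exists [set z : prod_topology (fun _ : dual E => K^o) *
      prod_topology (fun _ : dual E => K^o) | A (z.1 phi, z.2 phi)]; last by [].
  set B := [set z | _].
  set Pt := prod_topology _ in B *.
  pose P (p : {classic dual E} * set (Pt * Pt)) := `[< @entourage (Uniform.Pack
    (Uniform.class (initial_topology (@proj _ (fun _ : dual E => K^o) p.1)))) p.2 >].
  have BP : P (phi, B) by apply/asboolP; exists A.
  pose v : {p | P p} := exist _ (phi, B) BP.
  exists B => //.
  exists [fset v]%fset; first by move=> ? _; exact: in_setT.
  rewrite eqEsubset; split=> z; first by move=> /(_ v); apply; rewrite /= inE.
  by move=> Bz ? /=; rewrite inE => /eqP ->.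
move=> /xc; rewrite !near_simpl.
case=> [[P Q] [/= xP xQ]] PQ.
exists (sval phi @` P, sval phi @` Q) => /=.
  split.
    by apply: (@filterS _ \oo _ _ _ _ xP) => n Pn; exists (x n).
  by apply: (@filterS _ \oo _ _ _ _ xQ) => n Qn; exists (x n).
by case=> _ _ /= [[a Pa <-] [b Qb <-]]; apply: (PQ (a, b)).
Qed.

End WeakTopology.

(** * Bounded sequences and weakly compact l2 balls *)

Lemma sum_half_pow (R : realType) n : \sum_(m < n) (2^-1 : R) ^+ m.+1 <= 1.
Proof.
suff -> : \sum_(m < n) (2^-1 : R) ^+ m.+1 = 1 - 2^-1 ^+ n.
  by rewrite gerBl exprn_ge0// invr_ge0.
elim: n => [|n IHn]; first by rewrite big_ord0 expr0 subrr.
by rewrite big_ord_recr/= IHn exprS; field.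
Qed.

Lemma bounded_monotone_tail (R : realType) (u : nat -> R) (C : R) :
  (forall m n, (m <= n)%N -> u m <= u n) -> (forall n, u n <= C) ->
  forall e, 0 < e -> exists n, forall m, u m <= u n + e.
Proof.
move=> u_mono uC e e0.
have sup_u : has_sup (range u).
  by split; [exists (u 0), 0|exists C => _ [n _ <-]].
have [_ [n _ <-] un] := sup_adherent e0 sup_u; exists n => m.
by rewrite -lerBlDr (le_trans _ (ltW un))// lerB// sup_upper_bound//; exists m.
Qed.

Lemma bounded_sum_tail (R : realType) (a : nat -> R) (C : R) :
  (forall n, 0 <= a n) -> (forall N, \sum_(i < N) a i <= C) ->
  forall e, 0 < e -> exists n, forall m, \sum_(n <= i < m) a i <= e.
Proof.
move=> a0 aC e e0.
have mono m n : (m <= n)%N -> \sum_(i < m) a i <= \sum_(i < n) a i.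
  move=> mn; rewrite -!(big_mkord xpredT a) (big_cat_nat (leq0n _) mn)//= lerDl.
  by rewrite sumr_ge0.
have [n nP] := bounded_monotone_tail mono aC e0; exists n => m.
have [mn|/ltnW nm] := leqP m n; first by rewrite big_geq// ltW.
have := nP m; rewrite -!(big_mkord xpredT a) (big_cat_nat (leq0n _) nm)//=.
by rewrite lerD2l.
Qed.

Lemma cauchy_modulus (R : realType) (k : scalar_kind)
    (V : normedModType (scalars R k)) (G : set_system V) (PG : ProperFilter G) :
  cauchy G <-> forall e : R, 0 < e -> exists f, \forall g \near G, modulus (f - g) < e.
Proof.
split=> [/cauchyP Gc e e0|Gc].
  have [|f Gf] := Gc (of_real k e); first by rewrite -(rmorph0 (@of_real R k)) ltr_of_real.
  by exists f; apply: filterS Gf => g; rewrite -ball_normE/= modulusE ltr_of_real.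
apply/cauchyP => e e0.
have [|f Gf] := Gc (real_part e).
  by rewrite -(ltr_of_real k) rmorph0 real_partK// ltW.
exists f; apply: filterS Gf => g; rewrite -ball_normE/=.
by rewrite -(ltr_of_real k) -modulusE real_partK// ltW.
Qed.

Section BoundedSequences.
Variables (R : realType) (k : scalar_kind).
Local Notation K := (scalars R k).

(** Bounded sequences are a target space in which square summable families form a
    weakly compact set whose weak topology is that of coordinates. *)
Definition bounded_seq_pred : {pred nat -> K^o} :=
  [pred f | `[< exists C : R, forall n, modulus (f n) <= C >]].

Record bounded_seq := BoundedSeq {
  bounded_seq_val : nat -> K^o;
  bounded_seq_valP : bounded_seq_val \in bounded_seq_pred }.

Lemma bounded_seq_closed : submod_closed bounded_seq_pred.
Proof.
split=> [|a f g /asboolP[C fC] /asboolP[D gD]]; apply/asboolP.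
  by exists 0 => n; rewrite modulus0.
exists (modulus a * C + D) => n; apply: le_trans (ler_modulusD _ _) _.
by rewrite lerD// modulusM ler_wpM2l// modulus_ge0.
Qed.

HB.instance Definition _ :=
  GRing.isSubmodClosed.Build K (nat -> K^o) bounded_seq_pred bounded_seq_closed.

HB.instance Definition _ := [isSub for bounded_seq_val].
HB.instance Definition _ := [Choice of bounded_seq by <:].
HB.instance Definition _ := [SubChoice_isSubLmodule of bounded_seq by <:].

Implicit Types f g : bounded_seq.

Definition bounded_seq_sup f : R := sup (range (fun n => modulus (val f n))).

Lemma bounded_seq_has_sup f : has_sup (range (fun n => modulus (val f n))).
Proof.
split; first by exists (modulus (val f 0)), 0.
by have /asboolP[C fC] := valP f; exists C => _ [n _ <-].
Qed.

Lemma bounded_seq_ub f n : modulus (val f n) <= bounded_seq_sup f.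
Proof. by apply: sup_upper_bound; [exact: bounded_seq_has_sup|exists n]. Qed.

Lemma bounded_seq_sup_le f c : (forall n, modulus (val f n) <= c) ->
  bounded_seq_sup f <= c.
Proof.
move=> fc; apply: ge_sup; first exact: (bounded_seq_has_sup f).1.
by move=> _ [n _ <-].
Qed.

Definition bounded_seq_norm f : K := of_real k (bounded_seq_sup f).

Lemma ler_bounded_seq_normD f g :
  bounded_seq_norm (f + g) <= bounded_seq_norm f + bounded_seq_norm g.
Proof.
rewrite /bounded_seq_norm -rmorphD ler_of_real; apply: bounded_seq_sup_le => n.
by apply: le_trans (ler_modulusD _ _) _; rewrite lerD// bounded_seq_ub.
Qed.

Lemma bounded_seq_sup_ge0 f : 0 <= bounded_seq_sup f.
Proof. exact: le_trans (modulus_ge0 _) (bounded_seq_ub f 0). Qed.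

Lemma bounded_seq_normZ (a : K) f :
  bounded_seq_norm (a *: f) = `|a| * bounded_seq_norm f.
Proof.
have le1 b g : bounded_seq_sup (b *: g) <= modulus b * bounded_seq_sup g.
  apply: bounded_seq_sup_le => n; rewrite modulusM.
  by rewrite ler_wpM2l ?modulus_ge0 ?bounded_seq_ub.
rewrite /bounded_seq_norm modulusE -rmorphM; congr of_real; apply/eqP.
rewrite eq_le le1/=; have [->|a0] := eqVneq a 0.
  by rewrite modulus0 mul0r bounded_seq_sup_ge0.
have := le1 a^-1 (a *: f); rewrite scalerA mulVf// scale1r modulus_inv.
by rewrite ler_pdivlMl// modulus_gt0.
Qed.

Lemma bounded_seq_norm0_eq0 f : bounded_seq_norm f = 0 -> f = 0.
Proof.
move=> /(congr1 (@real_part R k)); rewrite of_realK raddf0 => f0.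
apply: val_inj; apply/funext => n; apply/eqP.
by rewrite -(modulus_eq0 (val f n)) eq_le modulus_ge0 andbT -f0 bounded_seq_ub.
Qed.

HB.instance Definition _ := Lmodule_isNormed.Build K bounded_seq
  ler_bounded_seq_normD bounded_seq_normZ bounded_seq_norm0_eq0.

Lemma bounded_seq_modulus f : modulus f = bounded_seq_sup f.
Proof. exact: of_realK. Qed.

Lemma modulus_bounded_seq_ub f n : modulus (val f n) <= modulus f.
Proof. by rewrite bounded_seq_modulus bounded_seq_ub. Qed.

Lemma modulus_bounded_seq_le f c : (forall n, modulus (val f n) <= c) ->
  modulus f <= c.
Proof. by rewrite bounded_seq_modulus; exact: bounded_seq_sup_le. Qed.

Lemma bounded_seq_complete (G : set_system bounded_seq) :
  ProperFilter G -> cauchy G -> cvg G.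
Proof.
move=> PG /cauchy_modulus Gc.
have Gn n : cvg ((fun f : bounded_seq => val f n : K^o) @ G).
  apply: scalars_complete; apply/cauchy_modulus => e e0.
  have [f Gf] := Gc _ e0; exists (val f n); rewrite nbhs_simpl/=.
  apply: filterS Gf => g; apply: le_lt_trans.
  exact: (modulus_bounded_seq_ub (f - g) n).
pose l n := lim ((fun f : bounded_seq => val f n : K^o) @ G).
have Gl (e : R) : 0 < e -> \forall f \near G, forall n, modulus (val f n - l n) <= e.
  move=> e0; have e20 : 0 < e / 2 by rewrite divr_gt0.
  have [h Gh] := Gc _ e20.
  apply: filterS (Gh) => f hf n.
  have c1 : (fun g : bounded_seq => val f n - val g n : K^o) @ G --> val f n - l n.
    by apply: cvgB; [exact: cvg_cst|exact: Gn].
  apply: (modulus_cvg_le _ c1); apply: filterS Gh => g hg.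
  rewrite (splitr e); apply: le_trans (modulus_bounded_seq_ub (f - g) n) _.
  by apply: le_trans (ler_modulusBD f h g) _; rewrite lerD// ltW// modulusBC.
have lP : l \in bounded_seq_pred.
  have [f fl] := filter_ex (Gl _ ltr01); apply/asboolP.
  have /asboolP[C fC] := valP f; exists (1 + C) => n.
  rewrite -(subrK (val f n) (l n)); apply: le_trans (ler_modulusD _ _) _.
  by rewrite lerD// modulusBC.
apply/cvg_ex; exists (BoundedSeq lP).
apply/(@cvg_modulus R k) => e e0; have e20 : 0 < e / 2 by rewrite divr_gt0.
apply: filterS (Gl _ e20) => f fl; apply: le_lt_trans (_ : e / 2 < e); last by lra.
by apply: modulus_bounded_seq_le => n; rewrite modulusBC; exact: fl.
Qed.

HB.instance Definition _ :=
  Uniform_isComplete.Build bounded_seq bounded_seq_complete.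

Lemma coordinate_functional n : exists phi : dual bounded_seq,
  forall f, sval phi f = val f n.
Proof.
apply: (@bounded_functional _ _ _ (fun f => val f n) 1) => // f.
by rewrite mul1r modulus_bounded_seq_ub.
Qed.

Definition l2_ball (C : R) : set bounded_seq :=
  [set f : bounded_seq | forall N, \sum_(n < N) modulus (val f n) ^+ 2 <= C].

Lemma weak_coordinate_cvg (I : Type) (F : set_system I) (FF : Filter F)
    (x : I -> bounded_seq) (l : bounded_seq) :
  (x : I -> weak bounded_seq) @ F --> (l : weak bounded_seq) ->
  forall n, (fun i => val (x i) n) @ F --> val l n.
Proof.
move=> /weak_cvgP xl n; have [phi phiE] := coordinate_functional n.
by have := xl phi; rewrite phiE; under eq_fun do rewrite phiE.
Qed.

Lemma l2_ball_limit (C : R) (I : Type) (F : set_system I) (FF : ProperFilter F)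
    (x : I -> bounded_seq) (l : nat -> K^o) :
  (forall n, (fun i => val (x i) n) @ F --> l n) ->
  (\forall i \near F, l2_ball C (x i)) ->
  forall N, \sum_(n < N) modulus (l n) ^+ 2 <= C.
Proof.
move=> xl xC N.
have cv : (fun i => \sum_(n < N) modulus (val (x i) n) ^+ 2) @ F -->
    \sum_(n < N) modulus (l n) ^+ 2.
  apply: cvg_big; first exact: add_continuous.
  move=> n _; rewrite expr2; under eq_fun do rewrite expr2.
  by apply: cvgM; exact: modulus_cvg.
by apply: (cvgr_to_le cv); apply: filterS xC => i; exact.
Qed.

(** Partial sums of squares are weakly continuous. *)
Lemma weak_closure_l2_ball (C : R) (A : set bounded_seq) : A `<=` l2_ball C ->
  closure (A : set (weak bounded_seq)) `<=` l2_ball C.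
Proof.
move=> AC f; rewrite closureEcvg => -[F FF [Ff FA]].
apply: (@l2_ball_limit _ _ F _ id); first exact: weak_coordinate_cvg.
by apply: FA => g /AC.
Qed.

Lemma unit_seq_in (i : nat) : (fun n => (n == i)%:R) \in bounded_seq_pred.
Proof.
apply/asboolP; exists 1 => n.
by case: (n == i); rewrite ?modulus0 ?ler01// modulus1.
Qed.

Definition unit_seq i := BoundedSeq (unit_seq_in i).

Lemma sum_unit_seqE (a : nat -> K) n j :
  val (\sum_(i < n) a i *: unit_seq i) j = if (j < n)%N then a j else 0.
Proof.
have -> : val (\sum_(i < n) a i *: unit_seq i) j = \sum_(i < n) a i * (j == i)%:R.
  exact: (big_morph (fun f : bounded_seq => val f j) (id1 := 0) (op1 := +%R)).
case: ltnP => [jn|nj].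
  rewrite (bigD1 (Ordinal jn))//= eqxx mulr1 big1 ?addr0// => i ij.
  by rewrite (_ : (j == i) = false) ?mulr0//; apply: contraNF ij => /eqP ji; apply/eqP/val_inj.
rewrite big1// => i _; rewrite (_ : (j == i) = false) ?mulr0//.
by apply/negbTE; rewrite neq_ltn (leq_trans (ltn_ord i) nj) orbT.
Qed.

(** Test the functional on the combinations of unit vectors with unimodular
    coefficients, whose norm is at most 1. *)
Lemma sum_functional_unit (phi : {linear bounded_seq -> K^o}) (C : R) :
  (forall f, modulus (phi f) <= C * modulus f) ->
  0 <= C -> forall N, \sum_(i < N) modulus (phi (unit_seq i)) <= C.
Proof.
move=> phiC C0 N.
pose v := \sum_(i < N) phase (phi (unit_seq i)) *: unit_seq i.
have v1 : modulus v <= 1.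
  apply: modulus_bounded_seq_le => j.
  rewrite (sum_unit_seqE (fun i => phase (phi (unit_seq i)))).
  by case: ifP => _; rewrite ?modulus_phase ?modulus0.
have := le_trans (phiC v) (ler_wpM2l C0 v1); rewrite mulr1; apply: le_trans.
rewrite linear_sum/= (eq_bigr (fun i : 'I_N => of_real k (modulus (phi (unit_seq i))))).
  by rewrite -rmorph_sum modulus_of_real// sumr_ge0// => i _; exact: modulus_ge0.
by move=> i _; rewrite linearZ/= [LHS]phaseM.
Qed.

Lemma l2_ball_coordinate (C : R) f n : l2_ball C f -> modulus (val f n) <= C + 1.
Proof.
move=> fC; have C0 : 0 <= C by have := fC 0; rewrite big_ord0.
have : modulus (val f n) ^+ 2 <= C.
  apply: le_trans (fC n.+1); rewrite big_ord_recr/= lerDr.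
  by apply: sumr_ge0 => i _; exact: sqr_ge0.
by have := modulus_ge0 (val f n); nra.
Qed.

(** Elements of an [l2] ball tend to 0, so they are norm limits of their
    truncations; their coordinates are uniformly bounded, and the values of
    [phi] on the unit vectors are summable. *)
Lemma l2_ball_functional (phi : dual bounded_seq) (C e : R) : 0 < e ->
  exists n, forall f, l2_ball C f ->
    modulus (sval phi f - \sum_(i < n) val f i * sval phi (unit_seq i)) <= e.
Proof.
case: phi => phi /= /continuous_linear_bound[D D0 phiD] e0.
have [C0|C0] := leP 0 C; last first.
  exists 0 => f /(_ 0); rewrite big_ord0 => C0'.
  by rewrite ltNge C0' in C0.
have C10 : 0 < C + 1 by rewrite ltr_wpDl.
have [n nP] := bounded_sum_tail (fun i => modulus_ge0 (phi (unit_seq i)))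
  (sum_functional_unit phiD (ltW D0)) (divr_gt0 e0 C10).
exists n => f fC; apply/ler_addgt0Pr => h h0.
have hD : 0 < (h / D) ^+ 2 by rewrite exprn_gt0// divr_gt0.
have [m0 m0P] := bounded_sum_tail (fun i => sqr_ge0 (modulus (val f i))) fC hD.
(* Beyond [n] the values on unit vectors are summably small, beyond [m0] the
   coordinates of [f] are small. *)
pose m := maxn n m0.
have fm i : (m <= i)%N -> modulus (val f i) <= h / D.
  move=> mi; have := m0P i.+1.
  rewrite big_nat_recr/=; last by rewrite (leq_trans _ mi)// leq_maxr.
  move=> le1; rewrite -ler_sqr ?nnegrE ?modulus_ge0 ?divr_ge0 ?(ltW h0) ?(ltW D0)//.
  apply: le_trans le1; rewrite lerDr sumr_ge0// => j _; exact: sqr_ge0.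
have sumE N : phi (\sum_(i < N) val f i *: unit_seq i) =
    \sum_(i < N) val f i * phi (unit_seq i).
  by rewrite linear_sum; apply: eq_bigr => i _; rewrite linearZ.
apply: le_trans (ler_modulusBD _ (\sum_(i < m) val f i * phi (unit_seq i)) _) _.
rewrite addrC; apply: lerD.
  rewrite -!(big_mkord xpredT (fun i => val f i * phi (unit_seq i))).
  rewrite (big_cat_nat (leq0n _) (leq_maxl n m0))/= addrAC subrr add0r.
  apply: le_trans (ler_modulus_sum _ _ _) _.
  apply: le_trans (_ : \sum_(n <= i < m) (C + 1) * modulus (phi (unit_seq i)) <= _).
    apply: ler_sum => i _; rewrite modulusM ler_wpM2r ?modulus_ge0//.
    exact: l2_ball_coordinate.
  by rewrite -mulr_sumr mulrC -ler_pdivlMr.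
rewrite -sumE -linearB; apply: le_trans (phiD _) _; rewrite mulrC -ler_pdivlMr//.
apply: modulus_bounded_seq_le => i.
rewrite (_ : val _ i = val f i - (if (i < m)%N then val f i else 0)); last first.
  by rewrite -sum_unit_seqE.
case: ltnP => [_|mi]; first by rewrite subrr modulus0 divr_ge0 ?(ltW h0) ?(ltW D0).
by rewrite subr0 fm.
Qed.

(** An ultrafilter on the ball converges coordinatewise; by
    [l2_ball_functional], coordinatewise convergence is weak convergence there. *)
Lemma l2_ball_weakly_compact (C : R) : compact (l2_ball C : set (weak bounded_seq)).
Proof.
rewrite compact_ultra => F FF FC.
have [l lP] := choice (fun n => @ultra_scalar_cvg R k _ F FF
  (fun f : bounded_seq => val f n) (C + 1)
  (filterS (fun f => @l2_ball_coordinate C f n) FC)).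
have PF : ProperFilter F by exact: ultra_proper.
have lC := @l2_ball_limit C _ F PF id l lP FC.
have lb : l \in bounded_seq_pred.
  apply/asboolP; exists (C + 1) => n.
  apply: (modulus_cvg_le _ (lP n)); apply: filterS FC => f.
  exact: l2_ball_coordinate.
exists (BoundedSeq lb); split=> //.
suff : (id : bounded_seq -> weak bounded_seq) @ F --> (BoundedSeq lb : weak bounded_seq) by [].
apply/weak_cvgP => phi; apply/cvg_modulus => e e0.
have e30 : 0 < e / 3 by rewrite divr_gt0.
have [n nP] := l2_ball_functional phi C e30.
have cv : (fun f : bounded_seq => \sum_(i < n) val f i * sval phi (unit_seq i) : K^o) @ F -->
    (\sum_(i < n) l i * sval phi (unit_seq i) : K^o).
  apply: cvg_big; first exact: add_continuous.
  by move=> i _; apply: cvgM; [exact: lP|exact: cvg_cst].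
move/cvg_modulus: cv => /(_ _ e30) cv.
apply: filterS2 FC cv => f fC fl.
have le1 := nP (BoundedSeq lb) lC; have le2 := nP f fC.
rewrite modulusBC in le2.
apply: le_lt_trans (ler_modulusBD _ (\sum_(i < n) l i * sval phi (unit_seq i)) _) _.
apply: le_lt_trans (lerD le1 (ler_modulusBD _ (\sum_(i < n) val f i * sval phi (unit_seq i)) _)) _.
by move: le2 fl; lra.
Qed.

Lemma l2_weakly_compact (E : normedModType K) (T : E -> bounded_seq) (C : R) :
  (forall x, modulus x <= 1 -> l2_ball C (T x)) -> weakly_compact T.
Proof.
move=> TC; have sub : T @` [set x | `|x| <= 1] `<=` l2_ball C.
  move=> _ [x /= x1 <-]; apply: TC.
  by rewrite -(ler_of_real k) -modulusE rmorph1.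
apply: (subclosed_compact (B := l2_ball C : set (weak bounded_seq))).
- exact: closed_closure.
- exact: l2_ball_weakly_compact.
- exact: weak_closure_l2_ball.
Qed.

End BoundedSequences.

(** * Finite-dimensional l1 charts *)

Section Charts.
Variables (R : realType) (k : scalar_kind).
Local Notation K := (scalars R k).
Implicit Types E F : normedModType K.

Lemma span_subspace E (t : seq E) : exists M : subspace_of E,
  {subset t <= M} /\ finite_dimensional (subspace_elt M).
Proof.
pose P : {pred E} := [pred x | `[< exists a : 'I_(size t) -> K,
  x = \sum_(i < size t) a i *: t`_i >]].
have Pcl : submod_closed P.
  split=> [|c x y /asboolP[a ->] /asboolP[b ->]]; apply/asboolP.
    by exists (fun=> 0); rewrite big1// => i _; rewrite scale0r.
  exists (fun i => c * a i + b i); rewrite scaler_sumr -big_split/=.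
  by apply: eq_bigr => i _; rewrite scalerDl scalerA.
have tP (i : 'I_(size t)) : t`_i \in P.
  apply/asboolP; exists (fun j => (j == i)%:R).
  rewrite (bigD1 i)//= eqxx scale1r big1 ?addr0// => j /negbTE ->.
  by rewrite scale0r.
exists (SubspaceOf Pcl); split=> [x /(nthP 0)[i it <-]|]; first exact: (tP (Ordinal it)).
exists (size t), (fun i => SubspaceElt (N := SubspaceOf Pcl) (tP i)).
move=> [x xP]; have /asboolP[a xa] := xP; exists a; apply: val_inj.
by rewrite raddf_sum.
Qed.

Lemma operator_norm_bound E F (T : {linear E -> F}) : continuous T ->
  0 <= operator_norm T /\
  forall x, modulus (T x) <= real_part (operator_norm T) * modulus x.
Proof.
move=> /continuous_linear_bound[C C0 TC].
have [] := @scalars_supremumP R k [set `|T x| | x in [set x | `|x| <= 1]] (of_real k C).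
- by exists `|T 0|, 0; rewrite //= normr0.
- by move=> _ [x _ <-].
- move=> _ [x /= x1 <-]; rewrite norm_le_modulus (le_trans (TC x))//.
  by rewrite ler_piMr ?(ltW C0)// -(ler_of_real k) -modulusE rmorph1.
rewrite -/(operator_norm T) => ub _.
have op0 : 0 <= operator_norm T.
  have := ub `|T 0|; rewrite linear0 normr0; apply; exists 0 => /=.
    by rewrite normr0.
  by rewrite linear0 normr0.
split=> // x; have [->|x0] := eqVneq x 0; first by rewrite linear0 !modulus0 mulr0.
have mx : 0 < modulus x by rewrite modulus_gt0.
have : `|T ((of_real k (modulus x))^-1 *: x)| <= operator_norm T.
  apply: ub; exists ((of_real k (modulus x))^-1 *: x) => //=.
  rewrite -(rmorph1 (@of_real R k)) norm_le_modulus modulusZ modulus_inv.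
  by rewrite (modulus_of_real _ (ltW mx)) mulVf ?gt_eqF.
rewrite -{1}(real_partK op0) norm_le_modulus linearZ modulusZ modulus_inv.
by rewrite (modulus_of_real _ (ltW mx)) ler_pdivrMl// mulrC.
Qed.

Lemma real_part_mono (z w : K) : z <= w -> real_part z <= real_part w.
Proof.
move=> zw; rewrite -subr_ge0 -(raddfB (@real_part R k)).
rewrite -(ler_of_real k) rmorph0 real_partK ?subr_ge0//.
Qed.

(** The Banach-Mazur distance is an infimum in the scalar field; this extracts an
    actual pair of isomorphisms from a bound on it. *)
Lemma infimum_near (A : set K) (lambda : K) : A !=set0 -> (forall x, A x -> 0 <= x) ->
  infimum 0 A <= lambda -> exists2 d, A d & real_part d < real_part lambda + 1.
Proof.
move=> A0 A_ge0 inf_le; apply: contrapT => nA.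
have Age x : A x -> real_part lambda + 1 <= real_part x.
  by move=> Ax; rewrite leNgt; apply/negP => xl; apply: nA; exists x.
pose B := [set real_part x | x in A].
have infB : has_inf B.
  split; first by case: A0 => x Ax; exists (real_part x), x.
  by exists (real_part lambda + 1) => _ [x Ax <-]; exact: Age.
have infA : infimums A (infimum 0 A).
  rewrite /infimum ifF; last by apply/negbTE/eqP => A00; case: A0 => x; rewrite A00.
  apply: xgetPex; exists (of_real k (inf B)); split=> [x Ax|y lby].
    rewrite -(real_partK (A_ge0 _ Ax)) ler_of_real.
    by apply: ge_inf; [exact: infB.2|exists x].
  case: A0 => x0 Ax0; have yx0 := lby _ Ax0.
  have yE : of_real k (real_part y) = y.
    rewrite -[y in RHS](subKr x0) -{1}(subKr x0 y) raddfB rmorphB/=.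
    by rewrite (real_partK (A_ge0 _ Ax0)) real_partK ?subr_ge0.
  rewrite -yE ler_of_real; apply: lb_le_inf; first exact: infB.1.
  by move=> _ [x Ax <-]; apply: real_part_mono; exact: lby.
suff /real_part_mono : of_real k (real_part lambda + 1) <= lambda.
  by rewrite of_realK gerDl ler10.
apply: le_trans inf_le; apply: infA.2 => x Ax.
by rewrite -(real_partK (A_ge0 _ Ax)) ler_of_real; exact: Age.
Qed.

Definition l1 n (v : 'rV[K]_n) : R := \sum_(j < n) modulus (v ord0 j).

(** A chart identifies a subspace with [l1] of dimension [chart_dim], the whole
    distortion being put on one side. Coordinates are a total function so that
    charts with different domains can be compared on the same vectors. *)
Record ell1_chart (E : normedModType K) (L : R) := Ell1Chart {
  chart_dim : nat;
  chart_dom : subspace_of E;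
  chart_coord : E -> 'rV[K]_chart_dim;
  chart_point : 'rV[K]_chart_dim -> E;
  chart_coordD : forall a x y, x \in chart_dom -> y \in chart_dom ->
    chart_coord (a *: x + y) = a *: chart_coord x + chart_coord y;
  chart_point_dom : forall v, chart_point v \in chart_dom;
  chart_pointK : forall v, chart_coord (chart_point v) = v;
  chart_coord_ge : forall x, x \in chart_dom -> modulus x <= l1 (chart_coord x);
  chart_coord_le : forall x, x \in chart_dom -> l1 (chart_coord x) <= L * modulus x
}.

Lemma l1E n (v : ell1 K n) : modulus v = l1 v.
Proof.
rewrite {1}/modulus (_ : `|v| = ell1_norm v)// raddf_sum; apply: eq_bigr => i _.
by [].
Qed.

Lemma script_L1_charts E : script_L1_space E ->
  exists2 L : R, 1 <= L & forall t : seq E, exists c : ell1_chart E L,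
    {subset t <= chart_dom c}.
Proof.
case=> lambda lambda1 HE; exists (real_part lambda + 2).
  rewrite -lerBlDr; apply: le_trans (real_part_mono lambda1).
  by rewrite -(rmorph1 (of_real k)) of_realK; lra.
move=> t; have [M [tM Mfin]] := span_subspace t.
have [N [n [MN [T0 [S0 iso0]] dN]]] := HE M Mfin.
have [||d [T [S [[Tc Sc TS ST] ->]]] dlt] := infimum_near _ _ dN.
- by exists (operator_norm T0 * operator_norm S0), T0, S0.
- move=> _ [T [S [[Tc Sc _ _] ->]]].
  by rewrite mulr_ge0//; [have [] := operator_norm_bound Tc|have [] := operator_norm_bound Sc].
have [opT0 Ta] := operator_norm_bound Tc; have [opS0 Sb] := operator_norm_bound Sc.
have a0 : 0 <= real_part (operator_norm T) by rewrite -(ler_of_real k) rmorph0 real_partK.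
have b0 : 0 <= real_part (operator_norm S) by rewrite -(ler_of_real k) rmorph0 real_partK.
move: dlt; rewrite -{1}(real_partK opT0) real_partZ.
move: (real_part (operator_norm T)) (real_part (operator_norm S)) a0 b0 Ta Sb.
move=> a b a0 b0 Ta Sb ab {opT0 opS0 Tc Sc}.
have a10 : 0 < a + 1 by rewrite ltr_wpDl.
(* The scaling factor must be positive even when [b = 0]; adding
   [(a + 1)^-1] increases the distortion by less than 1. *)
pose b' := b + (a + 1)^-1.
have bb' : b <= b' by rewrite lerDl invr_ge0 ltW.
have b'0 : 0 < b' by rewrite ltr_wpDl// invr_gt0.
have ab' : b' * a <= real_part lambda + 2.
  rewrite mulrDl (mulrC b) (_ : 2 = 1 + 1 :> R)// addrA lerD ?(ltW ab)//.
  by rewrite mulrC ler_pdivrMr// mul1r lerDl.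
pose beta : K := of_real k b'.
have beta0 : beta != 0 by rewrite -modulus_eq0 modulus_of_real ?(ltW b'0)// gt_eqF.
have mbeta : modulus beta = b' by rewrite modulus_of_real// ltW.
pose co (x : E) : 'rV[K]_n := beta *: (T (insubd 0 x) : 'rV[K]_n).
have co_val (v : subspace_elt N) : co (val v) = beta *: (T v : 'rV[K]_n).
  by rewrite /co valKd.
have domE x : x \in N -> exists v : subspace_elt N, val v = x.
  by move=> xN; exists (SubspaceElt xN).
have l1co v : l1 (co (val v)) = b' * modulus (T v).
  by rewrite co_val -(l1E (beta *: T v)) modulusZ mbeta.
unshelve eexists (@Ell1Chart E _ n N co (fun v => val (S (beta^-1 *: v))) _ _ _ _ _).
- move=> c _ _ /domE[v <-] /domE[w <-].
  have -> : c *: val v + val w = val (c *: v + w) by rewrite linearP.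
  by rewrite !co_val linearP scalerDr !scalerA (mulrC c).
- by move=> v; exact: valP.
- by move=> v; rewrite co_val ST scalerA mulfV// scale1r.
- move=> _ /domE[v <-]; rewrite l1co -{1}(TS v).
  by apply: le_trans (Sb _) _; rewrite ler_wpM2r// modulus_ge0.
- move=> _ /domE[v <-]; rewrite l1co.
  apply: le_trans (_ : b' * (a * modulus v) <= _); first by rewrite ler_wpM2l// ltW.
  by rewrite mulrA ler_wpM2r// modulus_ge0.
by move=> x /tM /MN.
Qed.
End Charts.

(** * Averages over signs *)

Section SignAverage.
Variables (R : realType).

(** The mean of [f] over all signed sums [x +- v_1 +- ... +- v_n], by recursion on the
    family so that moments are computed by adding one vector at a time. *)
Fixpoint sign_avg (V : zmodType) (s : seq V) (f : V -> R) (x : V) : R :=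
  if s is v :: s' then (sign_avg s' f (x + v) + sign_avg s' f (x - v)) / 2
  else f x.

Section Generic.
Variable V : zmodType.
Implicit Types (s : seq V) (f g : V -> R).

Lemma sign_avg_le s f g x : (forall y, f y <= g y) ->
  sign_avg s f x <= sign_avg s g x.
Proof.
by move=> fg; elim: s x => //= v s IHs x; rewrite ler_pM2r ?invr_gt0// lerD.
Qed.

Lemma sign_avg_const s c x : sign_avg s (fun=> c) x = c.
Proof. by elim: s x => //= v s IHs x; rewrite !IHs; field. Qed.

Lemma sign_avgD s f g x :
  sign_avg s (fun y => f y + g y) x = sign_avg s f x + sign_avg s g x.
Proof. by elim: s x => //= v s IHs x; rewrite !IHs; field. Qed.

Lemma sign_avgZ s c f x : sign_avg s (fun y => c * f y) x = c * sign_avg s f x.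
Proof. by elim: s x => //= v s IHs x; rewrite !IHs; field. Qed.

Lemma sign_avg_sum (I : Type) (r : seq I) (f : I -> V -> R) s x :
  sign_avg s (fun y => \sum_(i <- r) f i y) x = \sum_(i <- r) sign_avg s (f i) x.
Proof.
elim: r => [|i r IHr].
  rewrite big_nil -[RHS](sign_avg_const s 0 x); congr sign_avg; apply/funext => y.
  by rewrite big_nil.
rewrite big_cons -IHr -sign_avgD; congr sign_avg; apply/funext => y.
by rewrite big_cons.
Qed.

Lemma sign_avg_map (W : zmodType) (h : {additive V -> W}) (f : W -> R) s x :
  sign_avg s (fun y => f (h y)) x = sign_avg [seq h v | v <- s] f (h x).
Proof. by elim: s x => //= v s IHs x; rewrite !IHs raddfD raddfB. Qed.

End Generic.

Lemma sign_avg_bound (K : numFieldType) (V : lmodType K) (s : seq V) (f : V -> R) x c :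
  (forall e : nat -> bool,
    f (x + \sum_(i < size s) (-1) ^+ e i *: s`_i) <= c) -> sign_avg s f x <= c.
Proof.
elim: s x => [|v s IHs] x /= fc.
  by have := fc (fun=> false); rewrite big_ord0 addr0.
have step (b : bool) : sign_avg s f (x + (-1) ^+ b *: v) <= c.
  apply: IHs => e; have := fc (fun i => if i is j.+1 then e j else b).
  by rewrite big_ord_recl/= addrA.
have := lerD (step false) (step true).
by rewrite expr0 expr1 scale1r scaleN1r ler_pdivrMr// mulr_natr mulr2n.
Qed.

Lemma sign_avg_bound_ge (K : numFieldType) (V : lmodType K) (s : seq V) (f : V -> R) x c :
  (forall e : nat -> bool,
    c <= f (x + \sum_(i < size s) (-1) ^+ e i *: s`_i)) -> c <= sign_avg s f x.
Proof.
move=> cf; rewrite -lerN2 -mulN1r -sign_avgZ.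
by apply: sign_avg_bound => e; rewrite mulN1r lerN2.
Qed.

Lemma sign_avg_jensen (V : zmodType) (s : seq V) (f : V -> R) x :
  sign_avg s f x ^+ 2 <= sign_avg s (fun y => f y ^+ 2) x.
Proof.
set m := sign_avg s f x.
have : 0 <= sign_avg s (fun y => f y ^+ 2 + (- (2 * m) * f y + m ^+ 2)) x.
  rewrite -[leLHS](sign_avg_const s 0 x); apply: sign_avg_le => y.
  by rewrite (_ : _ + _ = (f y - m) ^+ 2) ?sqr_ge0//; ring.
rewrite !sign_avgD sign_avgZ sign_avg_const -/m.
by set q := sign_avg _ _ _; nra.
Qed.

Section Moments.
Variable k : scalar_kind.
Local Notation K := (scalars R k).
Implicit Type s : seq K.

(** The parallelogram law, iterated. *)
Lemma sign_avg_sqr s x : sign_avg s (fun z => modulus z ^+ 2) x =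
  modulus x ^+ 2 + \sum_(z <- s) modulus z ^+ 2.
Proof.
elim: s x => [|z s IHs] x /=; first by rewrite big_nil addr0.
rewrite !IHs big_cons; have [c _ [-> ->]] := modulus_sqrDB x z.
by field.
Qed.

(** With [c] the inner product of [x] and [z], the mean of the fourth powers for
    [x + z] and [x - z] is [(|x|^2 + |z|^2)^2 + 4 c^2], and [c^2 <= |x|^2 |z|^2]. *)
Lemma sign_avg_pow4 s x : sign_avg s (fun z => modulus z ^+ 4) x <=
  modulus x ^+ 4 + 6 * modulus x ^+ 2 * (\sum_(z <- s) modulus z ^+ 2)
  + 3 * (\sum_(z <- s) modulus z ^+ 2) ^+ 2.
Proof.
elim: s x => [|z s IHs] x /=.
  by rewrite big_nil mulr0 expr0n/= mulr0 !addr0.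
rewrite big_cons ler_pdivrMr//; apply: le_trans (lerD (IHs _) (IHs _)) _.
set t := \sum_(_ <- _) _; have t0 : 0 <= t by apply: sumr_ge0 => i _; apply: sqr_ge0.
rewrite !(exprM _ 2 2); have [c cxz [-> ->]] := modulus_sqrDB x z.
have : c ^+ 2 <= modulus x ^+ 2 * modulus z ^+ 2.
  by rewrite -exprMn -(real_normK (num_real c)) lerXn2r// nnegrE ?mulr_ge0 ?modulus_ge0.
have := sqr_ge0 (modulus z).
move: (modulus x ^+ 2) (modulus z ^+ 2) => X Z Z0 cXZ.
rewrite -mulr_natr; nra.
Qed.

(** Khintchine's inequality between the first two moments. By homogeneity let the
    second moment be 1: then the fourth is at most 3, and the first is bounded
    below by integrating [u >= 3/4 u^2 - u^4/16]. *)
Lemma khintchine s :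
  Num.sqrt (\sum_(z <- s) modulus z ^+ 2) <= 2 * sign_avg s (@modulus R k K) 0.
Proof.
have t0 : 0 <= \sum_(z <- s) modulus z ^+ 2 by apply: sumr_ge0 => i _; apply: sqr_ge0.
have m4 := sign_avg_pow4 s 0; have m2 := sign_avg_sqr s 0.
move: m4 m2; rewrite modulus0 !expr0n/= mulr0 mul0r !add0r.
rewrite -[X in 3 * X ^+ 2](sqr_sqrtr t0) -[X in _ = X -> _](sqr_sqrtr t0).
set A := Num.sqrt _ => m4 m2.
have A0 : 0 <= A by apply: sqrtr_ge0.
have : 0 <= sign_avg s (fun z => A ^+ 3 * modulus z +
    (- (3 / 4 * A ^+ 2) * modulus z ^+ 2 + 1 / 16 * modulus z ^+ 4)) 0.
  rewrite -[leLHS](sign_avg_const s 0 0); apply: sign_avg_le => z.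
  have := modulus_ge0 z; move: (modulus z) => u u0.
  (* The two sides of the pointwise inequality touch at [u = 2 A]. *)
  rewrite (_ : _ + _ = u * (u - 2 * A) ^+ 2 * (u + 4 * A) / 16); last by field.
  apply: divr_ge0 => //; apply: mulr_ge0; first by rewrite mulr_ge0 ?sqr_ge0.
  by rewrite addr_ge0// mulr_ge0.
rewrite !sign_avgD !sign_avgZ m2.
have a_ge0 : 0 <= sign_avg s (@modulus R k K) 0.
  by rewrite -[leLHS](sign_avg_const s 0 0); apply: sign_avg_le => z; apply: modulus_ge0.
move: m4 a_ge0.
move: (sign_avg s (@modulus R k K) 0) (sign_avg s _ 0) => a b m4 a_ge0 ab.
have : 0 <= A ^+ 3 * (a - 9 / 16 * A) by nra.
have [->|An0] := eqVneq A 0.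
  by move=> _; rewrite mulr_ge0.
have A3 : 0 < A ^+ 3 by rewrite exprn_gt0// lt_def An0.
by rewrite pmulr_rge0//; lra.
Qed.

End Moments.

Lemma sum_mul_sqr_le (I : Type) (r : seq I) (a b : I -> R) :
  (\sum_(i <- r) a i * b i) ^+ 2 <=
  (\sum_(i <- r) a i ^+ 2) * (\sum_(i <- r) b i ^+ 2).
Proof.
elim: r => [|i r IHr]; first by rewrite !big_nil expr0n mulr0.
rewrite !big_cons; move: IHr.
have sa : 0 <= \sum_(i <- r) a i ^+ 2 by apply: sumr_ge0 => j _; apply: sqr_ge0.
have sb : 0 <= \sum_(i <- r) b i ^+ 2 by apply: sumr_ge0 => j _; apply: sqr_ge0.
move: (\sum_(_ <- _) _) sa (\sum_(_ <- _) _) sb (\sum_(_ <- _) _) => P P0 Q Q0 S SPQ.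
have XY : (S * a i * b i) ^+ 2 <= (P * b i ^+ 2) * (Q * a i ^+ 2).
  rewrite (_ : _ ^+ 2 = S ^+ 2 * (a i * b i) ^+ 2); last by ring.
  rewrite (_ : _ * _ * _ = P * Q * (a i * b i) ^+ 2); last by ring.
  by rewrite ler_wpM2r// sqr_ge0.
have X0 : 0 <= P * b i ^+ 2 by rewrite mulr_ge0// sqr_ge0.
have Y0 : 0 <= Q * a i ^+ 2 by rewrite mulr_ge0// sqr_ge0.
suff : 2 * (S * a i * b i) <= P * b i ^+ 2 + Q * a i ^+ 2 by lra.
move: (S * a i * b i) (P * b i ^+ 2) (Q * a i ^+ 2) XY X0 Y0 => Z X Y XY X0 Y0.
rewrite leNgt; apply/negP => ZXY.
have : (X + Y) ^+ 2 < (2 * Z) ^+ 2.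
  by rewrite ltr_sqr ?nnegrE ?(le_trans _ (ltW ZXY)) ?addr_ge0.
by have := sqr_ge0 (X - Y); rewrite !expr2 in XY *; lra.
Qed.

Section InL1.
Variable k : scalar_kind.
Local Notation K := (scalars R k).

Lemma sign_avg_l1 n (s : seq 'rV[K]_n) :
  sign_avg s (@l1 R k n) 0 =
  \sum_(j < n) sign_avg [seq v ord0 j | v : 'rV[K]_n <- s] (@modulus R k K) 0.
Proof.
rewrite (sign_avg_sum (index_enum _) (fun j (y : 'rV[K]_n) => modulus (y ord0 j))).
apply: eq_bigr => j _.
have cD : zmod_morphism (fun v : 'rV[K]_n => v ord0 j) by move=> v w; rewrite !mxE.
pose c : {additive 'rV[K]_n -> K} :=
  HB.pack (fun v : 'rV[K]_n => v ord0 j) (GRing.isZmodMorphism.Build _ _ _ cD).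
by rewrite (sign_avg_map c (@modulus R k K)) /= mxE.
Qed.

(** Khintchine's inequality in each coordinate, followed by Minkowski's inequality
    to exchange the [l1] sum over coordinates and the [l2] sum over vectors. *)
Lemma l1_cotype2 n (s : seq 'rV[K]_n) :
  \sum_(v <- s) l1 v ^+ 2 <= 4 * sign_avg s (@l1 R k n) 0 ^+ 2.
Proof.
pose sg (j : 'I_n) := Num.sqrt (\sum_(v <- s) modulus (v ord0 j) ^+ 2).
have sg0 j : 0 <= sg j by apply: sqrtr_ge0.
apply: (@le_trans _ _ ((\sum_j sg j) ^+ 2)).
  have -> : \sum_(v <- s) l1 v ^+ 2 =
      \sum_i \sum_j \sum_(v <- s) modulus (v ord0 i) * modulus (v ord0 j).
    under [RHS]eq_bigr do rewrite exchange_big/=.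
    rewrite exchange_big/=; apply: eq_bigr => v _; rewrite expr2 {1}/l1 mulr_suml.
    by apply: eq_bigr => i _; rewrite /l1 mulr_sumr.
  rewrite expr2 mulr_suml ler_sum// => i _; rewrite mulr_sumr ler_sum// => j _.
  rewrite -ler_sqr ?nnegrE ?mulr_ge0// ?sumr_ge0// => [|v _]; last first.
    by rewrite mulr_ge0 ?modulus_ge0.
  rewrite exprMn !sqr_sqrtr; first exact: sum_mul_sqr_le.
    by apply: sumr_ge0 => v _; apply: sqr_ge0.
  by apply: sumr_ge0 => v _; apply: sqr_ge0.
have sgle : \sum_j sg j <= 2 * sign_avg s (@l1 R k n) 0.
  rewrite sign_avg_l1 mulr_sumr ler_sum// => j _.
  by apply: le_trans (khintchine _); rewrite big_map.
rewrite (_ : 4 * _ = (2 * sign_avg s (@l1 R k n) 0) ^+ 2); last by ring.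
have ss : 0 <= \sum_j sg j by apply: sumr_ge0.
by rewrite lerXn2r// nnegrE// (le_trans ss).
Qed.

(** In each coordinate the mean is at most the quadratic mean, whose square is at
    most the largest modulus times the sum of the moduli; then apply the
    inequality between geometric and weighted arithmetic means. *)
Lemma sign_avg_l1_max n (s : seq 'rV[K]_n) (M : 'I_n -> R) (a : R) : 0 < a ->
  (forall v j, v \in s -> modulus (v ord0 j) <= M j) -> (forall j, 0 <= M j) ->
  sign_avg s (@l1 R k n) 0 * 2 <= a * \sum_(v <- s) l1 v + a^-1 * \sum_j M j.
Proof.
move=> a0 vM M0; rewrite sign_avg_l1 mulr_suml.
rewrite /l1 exchange_big/= !mulr_sumr -big_split/= ler_sum// => j _.
set A := \sum_(v <- s) _.
have A0 : 0 <= A by apply: sumr_ge0 => v _; apply: modulus_ge0.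
have := sign_avg_jensen [seq v ord0 j | v : 'rV[K]_n <- s] (@modulus R k K) 0.
rewrite sign_avg_sqr modulus0 expr0n add0r big_map => le1.
have le2 : \sum_(v <- s) modulus (v ord0 j) ^+ 2 <= M j * A.
  rewrite /A mulr_sumr big_seq [leRHS]big_seq; apply: ler_sum => v vs.
  by rewrite expr2 ler_wpM2r ?modulus_ge0 ?vM.
move: (le_trans le1 le2); set m := sign_avg _ _ _ => mMA.
have : (m * 2) ^+ 2 <= (a * A + a^-1 * M j) ^+ 2.
  have : 4 * (M j * A) <= (a * A + a^-1 * M j) ^+ 2.
    rewrite -subr_ge0 (_ : _ - _ = (a * A - a^-1 * M j) ^+ 2) ?sqr_ge0//.
    by field; rewrite gt_eqF.
  by apply: le_trans; rewrite exprMn; lra.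
have B0 : 0 <= a * A + a^-1 * M j.
  by apply: addr_ge0; apply: mulr_ge0; rewrite ?invr_ge0 ?(ltW a0).
apply: contraTT; rewrite -!ltNge => lt.
by rewrite ltr_sqr// nnegrE// (le_trans B0)// ltW.
Qed.

End InL1.
End SignAverage.

(** * Functionals as limits over charts *)

Section ChartTheory.
Variables (R : realType) (k : scalar_kind).
Local Notation K := (scalars R k).
Variables (E : normedModType K) (L : R).
Implicit Types c : ell1_chart E L.

Lemma chart_coord0 c : chart_coord c 0 = 0.
Proof.
have := chart_coordD (e := c) (-1) (rpred0 (chart_dom c)) (rpred0 (chart_dom c)).
by rewrite scaler0 addr0 scaleN1r addNr.
Qed.

Lemma chart_coord_sum c (I : Type) (r : seq I) (a : I -> K) (x : I -> E) :
  (forall i, x i \in chart_dom c) ->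
  chart_coord c (\sum_(i <- r) a i *: x i) =
  \sum_(i <- r) a i *: chart_coord c (x i).
Proof.
move=> xc; elim: r => [|i r IHr]; first by rewrite !big_nil chart_coord0.
rewrite !big_cons chart_coordD ?IHr//.
by apply: rpred_sum => j _; exact: rpredZ.
Qed.

Lemma l1_0 n : l1 (0 : 'rV[K]_n) = 0.
Proof. by rewrite /l1 big1// => j _; rewrite mxE modulus0. Qed.

Lemma chart_coord_eq0 c x : x \in chart_dom c -> chart_coord c x = 0 -> x = 0.
Proof.
move=> xc x0; apply/eqP; rewrite -(modulus_eq0 (x : E)) eq_le modulus_ge0 andbT.
by have := chart_coord_ge xc; rewrite x0 l1_0.
Qed.

Lemma chart_coord_inj c x y : x \in chart_dom c -> y \in chart_dom c ->
  chart_coord c x = chart_coord c y -> x = y.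
Proof.
move=> xc yc xy; apply/eqP; rewrite -subr_eq0; apply/eqP.
rewrite addrC -scaleN1r; apply: (@chart_coord_eq0 c).
  by rewrite rpredD// rpredZ.
by rewrite chart_coordD// xy scaleN1r addNr.
Qed.

Definition chart_basis c (i : 'I_(chart_dim c)) : E := @chart_point R k E L c (delta_mx 0 i).

Lemma chart_coord_basis c (a : 'I_(chart_dim c) -> K) :
  chart_coord c (\sum_i a i *: chart_basis i) = \row_i a i.
Proof.
rewrite chart_coord_sum => [|i]; last exact: chart_point_dom.
rewrite [RHS]row_sum_delta; apply: eq_bigr => i _.
by rewrite chart_pointK mxE.
Qed.

Lemma chart_basis_in c a : \sum_i a i *: chart_basis (c := c) i \in chart_dom c.
Proof. by apply: rpred_sum => i _; rewrite rpredZ// chart_point_dom. Qed.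

Lemma modulus_chart_basis c (i : 'I_(chart_dim c)) : modulus (chart_basis i) <= 1.
Proof.
apply: le_trans (chart_coord_ge (chart_point_dom _)) _; rewrite chart_pointK.
rewrite /l1 (bigD1 i)//= big1 => [|j ji]; rewrite mxE ?eqxx ?modulus1 ?addr0//.
by rewrite (negbTE ji) modulus0.
Qed.

Lemma chart_basis_ge c a :
  \sum_i modulus (a i) <= L * modulus (\sum_i a i *: chart_basis (c := c) i).
Proof.
apply: le_trans (chart_coord_le (chart_basis_in a)); rewrite chart_coord_basis.
by apply: ler_sum => i _; rewrite mxE.
Qed.

Hypothesis charts : forall t : seq E, exists c : ell1_chart E L,
  {subset t <= chart_dom c}.

(** If dimensions are bounded, take a chart of maximal dimension. In a chart
    containing its basis and [x], the basis is still independent, hence spans by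
    maximality, and so [x] is a combination of the basis. *)
Lemma large_chart (m : nat) : ~ finite_dimensional E ->
  exists c : ell1_chart E L, (m <= chart_dim c)%N.
Proof.
move=> infE; apply: contrapT => noc; apply: infE.
pose P n := `[< exists c : ell1_chart E L, chart_dim c = n >].
have exP : exists n, P n.
  by have [c _] := charts [::]; exists (chart_dim c); apply/asboolP; exists c.
have Pm n : P n -> (n <= m)%N.
  move=> /asboolP[c cn]; rewrite leqNgt; apply/negP => mn; apply: noc.
  by exists c; rewrite cn ltnW.
case: (ex_maxnP exP Pm) => n /asboolP[c cn] nmax.
exists (chart_dim c), (@chart_basis c) => x.
have [c' tc'] := charts (x :: [seq chart_basis i | i <- index_enum 'I_(chart_dim c)]).
have bc' (i : 'I_(chart_dim c)) : chart_basis i \in chart_dom c'.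
    by apply: tc'; rewrite inE map_f ?orbT// mem_index_enum.
have xc' : x \in chart_dom c' by apply: tc'; rewrite inE eqxx.
pose A := \matrix_(i < chart_dim c) chart_coord c' (chart_basis i).
have coordA (u : 'rV_(chart_dim c)) : chart_coord c' (\sum_i u 0 i *: chart_basis i) = u *m A.
  rewrite chart_coord_sum// mulmx_sum_row; apply: eq_bigr => i _.
  by rewrite rowK.
have freeA : row_free A.
  rewrite -kermx_eq0; apply/rowV0P => u /sub_kermxP uA.
  have /(congr1 (chart_coord c)) : \sum_i u 0 i *: chart_basis i = 0.
    apply: (@chart_coord_eq0 c'); last by rewrite coordA.
    by apply: rpred_sum => i _; exact: rpredZ.
  rewrite chart_coord0 chart_coord_basis => u0; apply/rowP => i.
  by move/rowP: u0 => /(_ i); rewrite !mxE.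
have dimle : (chart_dim c' <= chart_dim c)%N.
  by rewrite cn; apply: nmax; apply/asboolP; exists c'.
have fullA : row_full A.
  by rewrite /row_full eqn_leq rank_leq_col (eqP freeA).
have /submxP[D xD] : (chart_coord c' x <= A)%MS by apply: submx_full.
exists (fun i => D 0 i); apply: (@chart_coord_inj c') => //.
  by apply: rpred_sum => i _; exact: rpredZ.
by rewrite coordA.
Qed.

End ChartTheory.

Section ChartLimits.
Variables (R : realType) (k : scalar_kind).
Local Notation K := (scalars R k).
Variable (E : normedModType K).

(** The length is recorded so that indices up to [n] eventually lie below
    [size t]: a union over all indices can then be replaced by a finite one. *)
Definition seq_filter : set_system (seq E) :=
  filter_from setT (fun s : seq E => [set t : seq E | {subset s <= t} /\ (size s <= size t)%N]).

Global Instance seq_filter_proper : ProperFilter seq_filter.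
Proof.
apply: filter_from_proper; last by move=> s _; exists s; split.
apply: filter_from_filter; first by exists [::].
move=> s t _ _; exists (s ++ t) => // r [str].
rewrite size_cat => szr; split; split.
- by move=> x xs; apply: str; rewrite mem_cat xs.
- by apply: leq_trans szr; rewrite leq_addr.
- by move=> x xs; apply: str; rewrite mem_cat xs orbT.
- by apply: leq_trans szr; rewrite leq_addl.
Qed.

Variables (L : R) (ch : seq E -> ell1_chart E L).
Hypothesis chP : forall t, {subset t <= chart_dom (ch t)}.
Variable U : set_system (seq E).
Context {UU : UltraFilter U}.
Hypothesis UE : seq_filter `<=` U.

Lemma near_chart_dom x : \forall t \near U, x \in chart_dom (ch t).
Proof.
by apply: UE; exists [:: x] => // t [xt _]; apply: chP; apply: xt; rewrite inE.
Qed.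

Lemma near_size n : \forall t \near U, (n <= size t)%N.
Proof.
by apply: UE; exists (nseq n 0) => // t [_]; rewrite size_nseq.
Qed.

Definition chart_form (w : forall t, 'I_(chart_dim (ch t)) -> K) t x : K :=
  \sum_j w t j * chart_coord (ch t) x ord0 j.

(** Bounded coefficients in every chart define a functional in the limit, since a
    given vector is eventually in the domain of the charts. *)
Lemma chart_limit (w : forall t, 'I_(chart_dim (ch t)) -> K) :
  (forall t j, modulus (w t j) <= 1) ->
  exists phi : {linear E -> K^o},
    (forall x, modulus (phi x) <= L * modulus x) /\
    forall x, (fun t => chart_form w t x : K^o) @ U --> phi x.
Proof.
move=> w1; apply: ultralimit_functional.
  move=> x; apply: filterS (near_chart_dom x) => t xt.
  apply: le_trans (chart_coord_le xt); apply: le_trans (ler_modulus_sum _ _ _) _.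
  by apply: ler_sum => j _; rewrite modulusM ler_piMl ?modulus_ge0.
move=> a x y; apply: filterS2 (near_chart_dom x) (near_chart_dom y) => t xt yt.
rewrite /chart_form chart_coordD// mulr_sumr -big_split/=; apply: eq_bigr => j _.
by rewrite !mxE mulrDr mulrCA.
Qed.

End ChartLimits.

(** Use the conjugate signs of the coordinates of [x] as coefficients; the scaling
    that puts the functional in the dual ball costs the distortion [L]. *)
Lemma script_L1_norming (R : realType) (k : scalar_kind) (E : normedModType (scalars R k))
    (L : R) : 1 <= L ->
  (forall t : seq E, exists c : ell1_chart E L, {subset t <= chart_dom c}) ->
  forall x, exists p : dual_ball E, modulus x <= L * modulus (sval p x).
Proof.
move=> L1 /choice[ch chP] x.
have [U [UU UE]] := ultraFilterLemma (seq_filter_proper E).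
pose w t j := phase (chart_coord (ch t) x ord0 j).
have w1 t j : modulus (w t j) <= 1 by rewrite modulus_phase.
have [phi [phiL phix]] := chart_limit chP UE w1.
have L0 : 0 < L by rewrite (lt_le_trans ltr01).
have xphi : modulus x <= modulus (phi x).
  apply: (cvgr_to_ge (modulus_cvg _ (phix x))).
  apply: filterS (near_chart_dom chP UE x) => t xt.
  apply: le_trans (chart_coord_ge xt) _.
  rewrite /chart_form /l1 (eq_bigr (fun j => of_real k (modulus (chart_coord (ch t) x ord0 j)))).
    by rewrite -rmorph_sum modulus_of_real// sumr_ge0// => j _; exact: modulus_ge0.
  by move=> j _; rewrite phaseM.
have [|p pE] := @in_dual_ball _ _ _ ((of_real k L)^-1 \*: phi).
  move=> y /=; rewrite modulusZ modulus_inv modulus_of_real ?(ltW L0)//.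
  by rewrite ler_pdivrMl.
exists p; rewrite pE modulusZ modulus_inv modulus_of_real ?(ltW L0)//.
by rewrite mulVKf ?gt_eqF.
Qed.

(** * Unconditional functionals on infinite-dimensional spaces with l1 charts *)

Lemma ultra_pigeonhole (T : Type) (U : set_system T) (UU : UltraFilter U) (I : finType)
    (P : I -> T -> Prop) :
  (\forall t \near U, exists i, P i t) -> exists i, \forall t \near U, P i t.
Proof.
move=> UP; apply: contrapT => nP.
have UC i : U (~` [set t | P i t]).
  by have [Pi|//] := in_ultra_setVsetC [set t | P i t] UU; case: nP; exists i.
have UCA := @filter_forall _ _ _ U _ UC.
have [t [[i Pit] nPt]] := filter_ex (filterI UP (UCA _)).
exact: (nPt i).
Qed.

Section Mass.
Variables (R : realType) (k : scalar_kind).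
Local Notation K := (scalars R k).

Definition mass n (A : pred 'I_n) (v : 'rV[K]_n) : R :=
  \sum_j (A j)%:R * modulus (v ord0 j).

Lemma mass_pred0 n (v : 'rV[K]_n) : mass pred0 v = 0.
Proof. by rewrite /mass big1// => j _; rewrite mul0r. Qed.

Lemma sum_mass_le n (I : finType) (A : I -> pred 'I_n) (v : 'rV[K]_n) :
  (forall i i' j, A i j -> A i' j -> i = i') -> \sum_i mass (A i) v <= l1 v.
Proof.
move=> Adisj; rewrite /mass exchange_big/=; apply: ler_sum => j _.
rewrite -mulr_suml ler_piMl ?modulus_ge0//.
have [[i ji]|nj] := pselect (exists i, A i j).
  rewrite (bigD1 i)//= ji big1 ?addr0// => i' ii'; case: (boolP (A i' j)) => // ji'.
  by rewrite (Adisj _ _ _ ji ji') eqxx in ii'.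
by rewrite big1 ?ler01// => i _; case: (boolP (A i j)) => // ji; case: nj; exists i.
Qed.

Lemma mass_le_l1 n (A : pred 'I_n) (v : 'rV[K]_n) : mass A v <= l1 v.
Proof. by apply: ler_sum => j _; rewrite ler_piMl ?modulus_ge0//; case: (A j). Qed.

Lemma mass_minus_union n N (P : pred 'I_N) (A : pred 'I_n) (B : 'I_N -> pred 'I_n)
    (v : 'rV[K]_n) :
  mass A v <= mass (fun j => A j && ~~ [exists m, P m && B m j]) v +
    \sum_(m | P m) mass (B m) v.
Proof.
rewrite /mass exchange_big -big_split/=; apply: ler_sum => j _.
rewrite -mulr_suml -mulrDl ler_wpM2r ?modulus_ge0//.
have sum0 : 0 <= \sum_(m | P m) (B m j)%:R :> R by apply: sumr_ge0.
case: existsP => [[m /andP[Pm Bm]]|_] /=; last first.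
  by rewrite andbT lerDl.
rewrite andbF add0r (bigD1 m)//= Bm (le_trans (_ : _ <= 1)) ?lerDl ?sumr_ge0//.
by case: (A j).
Qed.

End Mass.

Section Spread.
Variables (R : realType) (k : scalar_kind) (E : normedModType (scalars R k)) (L : R).
Local Notation K := (scalars R k).
Hypothesis L1 : 1 <= L.

(** Seen in [c'], the signed sums of the basis of [c] have norm at least
    [dim c / L]. By [sign_avg_l1_max] the coordinatewise maximum of the basis
    vectors then has norm at least [dim c / L^3], and [A i] is the set where the
    [i]-th vector realizes it. *)
Lemma chart_basis_disjoint (c c' : ell1_chart E L) :
  (0 < chart_dim c)%N ->
  (forall i : 'I_(chart_dim c), chart_basis i \in chart_dom c') ->
  exists A : 'I_(chart_dim c) -> pred 'I_(chart_dim c'),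
    (forall i i' j, A i j -> A i' j -> i = i') /\
    (chart_dim c)%:R <= L ^+ 3 * \sum_i mass (A i) (chart_coord c' (chart_basis i)).
Proof.
move=> c0 bc'; have L0 : 0 < L by rewrite (lt_le_trans ltr01).
set v := fun i : 'I_(chart_dim c) => chart_coord c' (chart_basis i).
pose am j := [arg max_(i > Ordinal c0) modulus (v i ord0 j)]%O.
pose M j := modulus (v (am j) ord0 j).
have amP i j : modulus (v i ord0 j) <= M j.
  by rewrite /M /am; case: Order.TotalTheory.arg_maxP => // i' _; exact.
exists (fun i j => am j == i); split.
  by move=> i i' j /eqP -> /eqP.
have -> : \sum_i mass (fun j => am j == i) (v i) = \sum_j M j.
  rewrite /mass exchange_big/=; apply: eq_bigr => j _.
  rewrite (bigD1 (am j))//= eqxx mul1r big1 ?addr0// => i /negbTE ij.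
  by rewrite eq_sym ij mul0r.
pose s := [seq v i | i <- enum 'I_(chart_dim c)].
have avg_ge : (chart_dim c)%:R / L <= sign_avg s (@l1 R k _) 0.
  apply: (@sign_avg_bound_ge R K) => e; rewrite add0r.
  have -> : \sum_(i < size s) (-1) ^+ e i *: s`_i =
      chart_coord c' (\sum_(i < chart_dim c) (-1) ^+ e i *: chart_basis i).
    rewrite chart_coord_sum// -(big_mkord xpredT (fun i => (-1) ^+ e i *: s`_i)).
    rewrite size_map size_enum_ord big_mkord; apply: eq_bigr => i _.
    by rewrite (nth_map i) ?size_enum_ord// nth_ord_enum.
  have inc : \sum_(i < chart_dim c) (-1) ^+ e i *: chart_basis i \in chart_dom c'.
    by apply: rpred_sum => i _; exact: rpredZ.
  rewrite ler_pdivrMr// mulrC.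
  apply: le_trans (_ : L * modulus
      (\sum_(i < chart_dim c) (-1) ^+ e i *: chart_basis i) <= _).
    apply: le_trans (chart_basis_ge _).
    rewrite (eq_bigr (fun=> 1)) ?sumr_const ?card_ord// => i _.
    by case: (e i); rewrite ?expr0 ?expr1 ?modulusN modulus1.
  by rewrite ler_wpM2l ?(ltW L0)// chart_coord_ge.
have a0 : 0 < (L ^+ 2)^-1 by rewrite invr_gt0 exprn_gt0.
have sM w j : w \in s -> modulus (w ord0 j) <= M j by move=> /mapP[i _ ->].
(* With the weight [1 / L^2] the first term of the bound is at most half of the
   left-hand side. *)
have le2 := sign_avg_l1_max a0 sM (fun j => modulus_ge0 _).
have sl1 : \sum_(w <- s) l1 w <= (chart_dim c)%:R * L.
  rewrite big_map big_enum/=.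
  apply: le_trans (_ : \sum_(i < chart_dim c) L <= _); last first.
    by rewrite sumr_const card_ord mulr_natl.
  apply: ler_sum => i _; apply: le_trans (chart_coord_le (bc' i)) _.
  by rewrite ler_piMr ?(ltW L0)// modulus_chart_basis.
move: avg_ge le2 sl1; rewrite invrK.
move: (sign_avg _ _ _) (\sum_(w <- s) _) (\sum_j M j) => av sl SM.
move: (chart_dim c)%:R => d; rewrite ler_pdivrMr// => le1 le2 le3.
have le4 : (L ^+ 2)^-1 * sl <= (L ^+ 2)^-1 * (d * L) by rewrite ler_wpM2l// ltW.
have le5 : d * 2 <= ((L ^+ 2)^-1 * (d * L) + L ^+ 2 * SM) * L.
  apply: le_trans (_ : av * L * 2 <= _); first by rewrite ler_wpM2r.
  by rewrite mulrAC ler_wpM2r ?(ltW L0)// (le_trans le2)// lerD2r.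
move: le5; rewrite (_ : _ * L = d + L ^+ 3 * SM); first by lra.
by field; rewrite gt_eqF.
Qed.

(** Half of the average mass given by [chart_basis_disjoint]. *)
Definition spread_mass : R := (2 * L ^+ 3)^-1.

(** On average the [i]-th vector has mass [2 * spread_mass] on [A i], whereas the
    total mass of [l] over the disjoint sets [A i] is bounded independently of
    [dim c]: if the dimension is large, some [A i] is hardly charged by [l]. *)
Lemma spread_step (l : seq E) (eta : R) (c c' : ell1_chart E L) : 0 < eta ->
  2 * L ^+ 5 * (\sum_(z <- l) modulus z) / eta < (chart_dim c)%:R ->
  (forall i : 'I_(chart_dim c), chart_basis i \in chart_dom c') ->
  {subset l <= chart_dom c'} ->
  exists (i : 'I_(chart_dim c)) (A : pred 'I_(chart_dim c')),
    spread_mass <= mass A (chart_coord c' (chart_basis i)) /\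
    forall z, z \in l -> mass A (chart_coord c' z) <= eta.
Proof.
move=> eta0 large bc' lc'; have L0 : 0 < L by rewrite (lt_le_trans ltr01).
set D := \sum_(z <- l) _ in large.
have D0 : 0 <= D by apply: sumr_ge0 => z _; exact: modulus_ge0.
have c0 : (0 < chart_dim c)%N.
  rewrite -(ltr_nat R); apply: le_lt_trans large.
  by rewrite divr_ge0 ?(ltW eta0)// mulr_ge0// mulr_ge0// exprn_ge0 ?(ltW L0).
have [A [Adisj dimle]] := chart_basis_disjoint c0 bc'.
apply: contrapT => noi.
pose Z i := \sum_(z <- l) mass (A i) (chart_coord c' z).
have w_le i : mass (A i) (chart_coord c' (chart_basis i)) <=
    spread_mass + L / eta * Z i.
  have Z0 : 0 <= Z i.
    by apply: sumr_ge0 => z _; apply: sumr_ge0 => j _; rewrite mulr_ge0 ?modulus_ge0.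
  have le0 : 0 <= L / eta * Z i by rewrite mulr_ge0 ?divr_ge0 ?(ltW L0) ?(ltW eta0).
  have [lt|ge] := ltP (mass (A i) (chart_coord c' (chart_basis i))) spread_mass.
    by apply: le_trans (ltW lt) _; rewrite lerDl.
  have [z zl zeta] : exists2 z, z \in l & eta < mass (A i) (chart_coord c' z).
    apply: contrapT => noz; apply: noi; exists i, (A i); split=> // z zl.
    by rewrite leNgt; apply/negP => zeta; apply: noz; exists z.
  have etaZ : eta <= Z i.
    apply: le_trans (ltW zeta) _; rewrite /Z (big_rem z)//= lerDl.
    by apply: sumr_ge0 => ? _; apply: sumr_ge0 => j _; rewrite mulr_ge0 ?modulus_ge0.
  apply: le_trans (mass_le_l1 _ _) _; apply: le_trans (chart_coord_le (bc' i)) _.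
  apply: le_trans (_ : L <= _); first by rewrite ler_piMr ?(ltW L0)// modulus_chart_basis.
  rewrite (le_trans (_ : L <= L / eta * Z i))//; last first.
    by rewrite lerDr invr_ge0 mulr_ge0 ?exprn_ge0 ?(ltW L0).
  by rewrite mulrAC ler_pdivlMr// ler_wpM2l ?(ltW L0).
have sumZ : \sum_i Z i <= L * D.
  rewrite /Z exchange_big/= /D mulr_sumr big_seq [leRHS]big_seq.
  apply: ler_sum => z zl; apply: le_trans (sum_mass_le _ _) _; first exact: Adisj.
  exact: chart_coord_le (lc' _ zl).
have := le_trans dimle (ler_wpM2l (exprn_ge0 3 (ltW L0)) (ler_sum _ (fun i _ => w_le i))).
rewrite big_split/= sumr_const card_ord -mulr_sumr -(mulr_natr spread_mass) /spread_mass.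
move: (chart_dim c)%:R large => d large le1.
have le2 : L ^+ 3 * (L / eta * \sum_i Z i) <= L ^+ 5 * D / eta.
  rewrite (_ : _ * D / _ = L ^+ 3 * (L / eta * (L * D))); last by field; rewrite gt_eqF.
  by rewrite !ler_wpM2l ?exprn_ge0 ?divr_ge0 ?(ltW L0) ?(ltW eta0).
move: le1; rewrite mulrDr (_ : _ * (_ * d) = d / 2); last by field; rewrite gt_eqF.
rewrite (_ : 2 * L ^+ 5 * D / eta = 2 * (L ^+ 5 * D / eta)) in large; last by rewrite !mulrA.
move: (L ^+ 5 * D / eta) large le2 => x; lra.
Qed.

Hypothesis E_infinite : ~ finite_dimensional E.
Variable ch : seq E -> ell1_chart E L.
Hypothesis chP : forall t, {subset t <= chart_dom (ch t)}.
Variable U : set_system (seq E).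
Context {UU : UltraFilter U}.
Hypothesis UE : @seq_filter R k E `<=` U.

(** The index given by [spread_step] depends on the chart, but it ranges over a
    finite set, so that it is constant along the ultrafilter. Where the step does
    not apply the set is empty, so that the last bound holds in every chart. *)
Lemma spread_next (l : seq E) (eta : R) : 0 < eta ->
  exists (y : E) (A : forall t, pred 'I_(chart_dim (ch t))),
    [/\ modulus y <= 1,
        \forall t \near U, spread_mass <= mass (A t) (chart_coord (ch t) y) &
        forall t z, z \in l -> mass (A t) (chart_coord (ch t) z) <= eta].
Proof.
move=> eta0; set D := 2 * L ^+ 5 * (\sum_(z <- l) modulus z) / eta.
have [c cD] : exists c : ell1_chart E L, D < (chart_dim c)%:R.
  have [c cm] := large_chart
    (fun t => ex_intro (fun c : ell1_chart E L => {subset t <= chart_dom c}) _ (@chP t))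
    (Num.truncn D).+1 E_infinite.
  by exists c; apply: lt_le_trans (truncnS_gt D) _; rewrite ler_nat.
pose P (i : 'I_(chart_dim c)) t (A : pred 'I_(chart_dim (ch t))) :=
  spread_mass <= mass A (chart_coord (ch t) (chart_basis i)) /\
  forall z, z \in l -> mass A (chart_coord (ch t) z) <= eta.
have [|i Pi] := @ultra_pigeonhole _ U UU _ (fun i t => exists A, P i t A).
  have nb : \forall t \near U, forall i : 'I_(chart_dim c), chart_basis i \in chart_dom (ch t).
    by apply: filter_forall => i; exact: near_chart_dom.
  have nl : \forall t \near U, {subset l <= chart_dom (ch t)}.
    by apply: UE; exists l => // t [lt _] x /lt; exact: chP.
  apply: filterS2 nb nl => t bt lt.
  by have [i [A PA]] := spread_step eta0 cD bt lt; exists i, A.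
have exA t : exists A, ((exists A, P i t A) -> P i t A) /\
    (forall z, z \in l -> mass A (chart_coord (ch t) z) <= eta).
  have [[A PA]|nA] := pselect (exists A, P i t A).
    by exists A; split=> [_|]; [exact: PA|exact: PA.2].
  by exists pred0; split=> [PA|z _]; [case: nA|rewrite mass_pred0 ltW].
pose A t := sval (cid (exA t)); have AP t := svalP (cid (exA t)).
exists (chart_basis i), A; split; first exact: modulus_chart_basis.
  by apply: filterS Pi => t /(AP t).1 [].
by move=> t z /(AP t).2.
Qed.

(** Iterate [spread_next] along the list of the vectors chosen so far, with
    geometrically decreasing bounds. *)
Lemma spread_sequence : exists (y : nat -> E)
    (A : nat -> forall t, pred 'I_(chart_dim (ch t))),
  [/\ forall n, modulus (y n) <= 1,
      forall n, \forall t \near U, spread_mass <= mass (A n t) (chart_coord (ch t) (y n)) &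
      forall m n t, (m < n)%N ->
        mass (A n t) (chart_coord (ch t) (y m)) <= spread_mass / 2 * 2^-1 ^+ n.+1].
Proof.
have sc0 : 0 < spread_mass by rewrite invr_gt0 mulr_gt0// exprn_gt0// (lt_le_trans ltr01).
have /choice[f fP] (ln : seq E * nat) :
    exists yA : E * (forall t, pred 'I_(chart_dim (ch t))),
    [/\ modulus yA.1 <= 1,
        \forall t \near U, spread_mass <= mass (yA.2 t) (chart_coord (ch t) yA.1) &
        forall t z, z \in ln.1 ->
          mass (yA.2 t) (chart_coord (ch t) z) <= spread_mass / 2 * 2^-1 ^+ ln.2.+1].
  have [|y [A]] := @spread_next ln.1 (spread_mass / 2 * 2^-1 ^+ ln.2.+1).
    by apply: mulr_gt0; [exact: divr_gt0|rewrite exprn_gt0// invr_gt0].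
  by exists (y, A).
pose fix hist n : seq E := if n is m.+1 then (f (hist m, m)).1 :: hist m else [::].
exists (fun n => (f (hist n, n)).1), (fun n => (f (hist n, n)).2); split.
- by move=> n; have [] := fP (hist n, n).
- by move=> n; have [] := fP (hist n, n).
move=> m n t mn; have [_ _] := fP (hist n, n); apply.
elim: n mn => // n IHn; rewrite ltnS leq_eqVlt inE => /predU1P[->|/IHn ->].
  by rewrite eqxx.
by rewrite orbT.
Qed.

(** Removing the later sets from [A n] leaves half of the mass of [y n], and makes
    the sets disjoint. The functional [psi n] sums the coordinates on the [n]-th
    set against the signs of [y n]; disjointness bounds the sum of the moduli by
    one [l1] norm. *)
Lemma chart_wuc : exists (y : nat -> E) (psi : nat -> {linear E -> K^o}),
  [/\ forall n, modulus (y n) <= 1,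
      forall n, spread_mass / 2 <= modulus (psi n (y n)) &
      forall N x, \sum_(n < N) modulus (psi n x) <= L * modulus x].
Proof.
have L0 : 0 < L by rewrite (lt_le_trans ltr01).
have sc0 : 0 < spread_mass by rewrite invr_gt0 mulr_gt0// exprn_gt0.
have [y [A [y1 Ay Am]]] := spread_sequence.
(* The sets [B n t] with [size t < n] are empty, so only finitely many later
   sets are removed and disjointness holds for all pairs of indices. *)
pose B n t : pred 'I_(chart_dim (ch t)) := fun j => (n <= size t)%N &&
  (A n t j && ~~ [exists m : 'I_(size t).+1, (n < m)%N && A m t j]).
have Bdisj t n m j : B n t j -> B m t j -> n = m.
  move=> /andP[nt /andP[Anj /existsPn nB]] /andP[mt /andP[Amj /existsPn mB]].
  case: (ltngtP n m) => // [nm|mn].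
    by have := nB (Ordinal (mt : (m < (size t).+1)%N)); rewrite /= nm Amj.
  by have := mB (Ordinal (nt : (n < (size t).+1)%N)); rewrite /= mn Anj.
have By n : \forall t \near U, spread_mass / 2 <= mass (B n t) (chart_coord (ch t) (y n)).
  apply: filterS2 (Ay n) (near_size UE n) => t Ant nt.
  have := mass_minus_union (fun m : 'I_(size t).+1 => (n < m)%N) (A n t)
    (fun m => A m t) (chart_coord (ch t) (y n)).
  rewrite [X in _ <= X + _](_ : _ = mass (B n t) (chart_coord (ch t) (y n))); last first.
    by apply: eq_bigr => j _; rewrite /B nt.
  have : \sum_(m < (size t).+1 | (n < m)%N) mass (A m t) (chart_coord (ch t) (y n)) <=
      spread_mass / 2.
    apply: le_trans (_ : \sum_(m < (size t).+1 | (n < m)%N)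
        spread_mass / 2 * 2^-1 ^+ m.+1 <= _).
      by apply: ler_sum => m nm; exact: Am.
    rewrite big_mkcond/=; apply: le_trans (_ : \sum_(m < (size t).+1)
        spread_mass / 2 * 2^-1 ^+ m.+1 <= _).
      apply: ler_sum => m _; case: ifP => // _; apply: mulr_ge0.
        by rewrite divr_ge0 ?(ltW sc0).
      by rewrite exprn_ge0 ?invr_ge0.
    by rewrite -mulr_sumr ler_piMr ?sum_half_pow// divr_ge0// ltW.
  lra.
pose w n t j := (B n t j)%:R * phase (chart_coord (ch t) (y n) ord0 j).
have w1 n t j : modulus (w n t j) <= (B n t j)%:R.
  by rewrite /w modulusM modulus_phase mulr1; case: (B n t j); rewrite ?modulus1 ?modulus0.
have w1' n t j : modulus (w n t j) <= 1 by apply: le_trans (w1 n t j) _; case: (B n t j).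
have [psi psiP] := choice (fun n => chart_limit chP UE (w1' n)).
exists y, psi; split=> [//|n|N x].
  apply: (cvgr_to_ge (modulus_cvg _ ((psiP n).2 (y n)))).
  apply: filterS (By n) => t Bt; rewrite (le_trans Bt)//.
  rewrite /chart_form /mass (eq_bigr (fun j => of_real k ((B n t j)%:R *
      modulus (chart_coord (ch t) (y n) ord0 j)))).
    rewrite -rmorph_sum modulus_of_real// sumr_ge0// => j _.
    by rewrite mulr_ge0 ?modulus_ge0.
  by move=> j _; rewrite /w -mulrA phaseM rmorphM rmorph_nat.
have cv : (fun t => \sum_(n < N) modulus (chart_form (w n) t x : K^o)) @ U -->
    \sum_(n < N) modulus (psi n x).
  by apply: cvg_big; [exact: add_continuous|move=> n _; apply: modulus_cvg; exact: (psiP n).2].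
apply: (cvgr_to_le cv); apply: filterS (near_chart_dom chP UE x) => t xt.
apply: le_trans (chart_coord_le xt).
apply: le_trans (sum_mass_le (A := fun n : 'I_N => B n t) _ _); last first.
  by move=> n m j Bn Bm; apply: val_inj; exact: Bdisj Bn Bm.
apply: ler_sum => n _; apply: le_trans (ler_modulus_sum _ _ _) _.
by apply: ler_sum => j _; rewrite modulusM ler_wpM2r ?modulus_ge0.
Qed.

End Spread.

Section WUC.
Variables (R : realType) (k : scalar_kind) (E : normedModType (scalars R k)).
Lemma script_L1_wuc : script_L1_space E -> ~ finite_dimensional E ->
  exists (d : R) (y : nat -> E) (q : nat -> dual_ball E), 
  [/\ 0 < d, forall n, modulus (y n) <= 1,
      forall n, d <= modulus (sval (q n) (y n)) &
      forall N x, \sum_(n < N) modulus (sval (q n) x) <= modulus x].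
Proof.
move=> /script_L1_charts[L L1 /choice[ch chP]] Einf.
have L0 : 0 < L by rewrite (lt_le_trans ltr01).
have [U [UU UE]] := ultraFilterLemma (seq_filter_proper E).
have [y [psi [y1 psiy sumpsi]]] := chart_wuc L1 Einf chP UE.
have /choice[q qP] n : exists q : dual_ball E, forall x,
    sval q x = ((of_real k L)^-1 \*: psi n) x.
  apply: in_dual_ball => x /=; rewrite modulusZ modulus_inv modulus_of_real ?(ltW L0)//.
  rewrite ler_pdivrMl//; apply: le_trans (sumpsi n.+1 x).
  by rewrite big_ord_recr/= lerDr sumr_ge0// => i _; exact: modulus_ge0.
have qE n x : modulus (sval (q n) x) = L^-1 * modulus (psi n x).
  by rewrite qP modulusZ modulus_inv modulus_of_real ?(ltW L0).
exists (L^-1 * (spread_mass L / 2)), y, q; split=> //.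
- by rewrite mulr_gt0 ?invr_gt0// divr_gt0// invr_gt0 mulr_gt0// exprn_gt0.
- by move=> n; rewrite qE ler_wpM2l// invr_ge0 ltW.
move=> N x; rewrite (eq_bigr (fun n : 'I_N => L^-1 * modulus (psi n x)))// -mulr_sumr ler_pdivrMl//.
exact: sumpsi.
Qed.
End WUC.

(** * Means of functions and bounded convergence *)

Section Averages.
Variables (R : realType) (S : Type).
Implicit Types (f : nat -> S -> R) (g h : S -> R) (p : seq S).

(** Blackwell's approachability. Write [V] for the squared distance, in [R^m], from
    the sum of the payoffs [f i s] to the set where all coordinates are at least
    [t d]. A point [s] chosen for the coefficients [c i], the positive parts of
    the current defects, increases [V] by at most [m]. *)
Lemma approachable f (d : R) (m : nat) : 0 < d -> d <= 1 ->
  (forall i s, 0 <= f i s <= 1) ->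
  (forall c : nat -> R, (forall i, 0 <= c i) ->
    exists s, d * \sum_(i < m) c i <= \sum_(i < m) c i * f i s) ->
  forall t, exists p, size p = t /\
    \sum_(i < m) Num.max 0 (t%:R * d - \sum_(s <- p) f i s) ^+ 2 <= m%:R * t%:R.
Proof.
move=> d0 d1 f01 fd; elim=> [|t [p [pt IH]]].
  exists [::]; split=> //; rewrite mulr0 big1// => i _.
  by rewrite big_nil mul0r subrr maxxx expr0n.
pose c i := Num.max 0 (t%:R * d - \sum_(s <- p) f i s).
have c0 i : 0 <= c i by rewrite le_max lexx.
have [s cs] := fd c c0; exists (s :: p); split; first by rewrite /= pt.
apply: le_trans (_ : \sum_(i < m) (c i ^+ 2 + (2 * (d * c i - c i * f i s) + 1)) <= _).
  apply: ler_sum => i _; rewrite big_cons.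
  have /andP[fi0 fi1] := f01 i s; set x := f i s in fi0 fi1 *.
  rewrite (_ : _ - _ = t%:R * d - \sum_(s <- p) f i s + (d - x)); last first.
    by rewrite -[t.+1]addn1 natrD; ring.
  set y := t%:R * d - _; have yc : y <= c i by rewrite le_max lexx orbT.
  have [z0|_] := leP 0 (y + (d - x)); last first.
    rewrite expr0n/=; apply: le_trans (_ : (c i + (d - x)) ^+ 2 <= _); first exact: sqr_ge0.
    by rewrite !expr2; nra.
  apply: le_trans (_ : (c i + (d - x)) ^+ 2 <= _).
    by rewrite ler_sqr ?nnegrE ?lerD2r// (le_trans z0)// lerD2r.
  by rewrite !expr2; nra.
rewrite !big_split/= sumr_const card_ord -!mulr_sumr big_split/= sumrN -mulr_sumr.
rewrite -[t.+1]addn1 natrD [leRHS]mulrDr mulr1 lerD//.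
by rewrite gerDr pmulr_rle0// subr_le0.
Qed.

Definition mean p g : R := (\sum_(s <- p) g s) / (size p)%:R.

(** The defects of [t] points are at most the square root of [m t], which is less
    than [t d / 2] for large [t]. *)
Lemma approach_mean f (d : R) (m : nat) : 0 < d -> d <= 1 ->
  (forall i s, 0 <= f i s <= 1) ->
  (forall c : nat -> R, (forall i, 0 <= c i) ->
    exists s, d * \sum_(i < m) c i <= \sum_(i < m) c i * f i s) ->
  exists p, (0 < size p)%N /\ forall i, (i < m)%N -> d / 2 <= mean p (f i).
Proof.
move=> d0 d1 f01 fd.
pose t := (Num.truncn (4 * m%:R / d ^+ 2)).+1.
have tP : 4 * m%:R / d ^+ 2 < t%:R by exact: truncnS_gt.
have [p [pt sump]] := approachable d0 d1 f01 fd t.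
have t0 : 0 < t%:R :> R by rewrite ltr0n.
exists p; split=> [|i im]; first by rewrite pt.
rewrite /mean pt ler_pdivlMr// leNgt; apply/negP => lt.
have : (d / 2 * t%:R) ^+ 2 < m%:R * t%:R.
  apply: lt_le_trans sump; rewrite (bigD1 (Ordinal im))//=.
  apply: ltr_wpDr; first by apply: sumr_ge0 => j _; exact: sqr_ge0.
  rewrite ltr_sqr ?nnegrE ?le_max ?lexx//; last by rewrite mulr_ge0 ?divr_ge0 ?(ltW d0)// ltW.
  by rewrite lt_max; apply/orP; right; lra.
apply/negP; rewrite -leNgt.
move: tP; rewrite ltr_pdivrMr ?exprn_gt0// => tP.
by rewrite (_ : _ ^+ 2 = (t%:R * d ^+ 2) / 4 * t%:R); [rewrite ler_pM2r//; lra|field].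
Qed.

Lemma mean_le p g h : (forall s, g s <= h s) -> mean p g <= mean p h.
Proof. by move=> gh; rewrite ler_wpM2r ?invr_ge0// ler_sum. Qed.

Lemma meanD p g h : mean p (fun s => g s + h s) = mean p g + mean p h.
Proof. by rewrite /mean big_split mulrDl. Qed.

Lemma mean_const p c : (0 < size p)%N -> mean p (fun=> c) = c.
Proof.
move=> p0; rewrite /mean big_const_seq count_predT iter_addr_0.
by rewrite -[c *+ _]mulr_natr mulfK// pnatr_eq0 -lt0n.
Qed.

Definition unit_valued g := forall s, 0 <= g s <= 1.

(** Eberlein's argument. The maxima [gm i m] of [f i, ..., f (i + m)] have means
    increasing with [m], so a length [M i] can be fixed after which they hardly
    change. The minimum [hm n] of the [gm i (M i)] for [i <= n] then keeps a large
    mean by modularity, so it is large at some point. *)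
Lemma bounded_convergence (mu : (S -> R) -> R) f (d : R) : 0 < d ->
  (forall g h, unit_valued g -> unit_valued h -> (forall s, g s <= h s) -> mu g <= mu h) ->
  (forall g h, unit_valued g -> unit_valued h ->
    mu (g \min h) + mu (g \max h) = mu g + mu h) ->
  (forall g c, unit_valued g -> (forall s, g s <= c) -> mu g <= c) ->
  (forall i, unit_valued (f i)) -> (forall i, d <= mu (f i)) ->
  exists M : nat -> nat, forall n, exists s, forall i, (i <= n)%N ->
    exists2 j, (i <= j <= i + M i)%N & d / 4 <= f j s.
Proof.
move=> d0 mu_le mu_mod mu_const f01 fd.
pose fix gm i m : S -> R := if m is m'.+1 then gm i m' \max f (i + m)%N else f i.
have u_max g h : unit_valued g -> unit_valued h -> unit_valued (g \max h).
  move=> g01 h01 s /=; have /andP[a b] := g01 s; have /andP[a' b'] := h01 s.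
  by rewrite le_max a/= ge_max b b'.
have u_min g h : unit_valued g -> unit_valued h -> unit_valued (g \min h).
  move=> g01 h01 s /=; have /andP[a b] := g01 s; have /andP[a' b'] := h01 s.
  by rewrite le_min a a'/= ge_min b.
have gm01 i m : unit_valued (gm i m) by elim: m => [|m IHm] /=; [exact: f01|exact: u_max].
have gm_mono i s m m' : (m <= m')%N -> gm i m s <= gm i m' s.
  elim: m' => [|m' IHm]; first by rewrite leqn0 => /eqP ->.
  rewrite leq_eqVlt => /predU1P[->//|]; rewrite ltnS => /IHm /le_trans; apply.
  by rewrite /= le_max lexx.
have gm_ge i s m j : (i <= j <= i + m)%N -> f j s <= gm i m s.
  move=> /andP[ij jim].
  have -> : j = (i + (j - i))%N by rewrite subnKC.
  have : (j - i <= m)%N by rewrite leq_subLR.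
  move: (j - i)%N => l lm; apply: le_trans (gm_mono i s _ _ lm).
  by case: l {lm} => [|l] /=; rewrite ?addn0// le_max lexx orbT.
have gm_ex i s m : exists2 j, (i <= j <= i + m)%N & gm i m s = f j s.
  elim: m => [|m [j /andP[ij jm] jE]] /=; first by exists i; rewrite ?addn0 ?leqnn.
  have [_|_] := leP (gm i m s) (f (i + m.+1)%N s).
    by exists (i + m.+1)%N; rewrite ?leq_addr ?leqnn.
  by exists j => //; rewrite ij (leq_trans jm)// leq_add2l.
have mu_gm i m m' : (m <= m')%N -> mu (gm i m) <= mu (gm i m').
  by move=> mm'; apply: mu_le => // s; exact: gm_mono.
have /choice[M MP] i : exists n, forall m, mu (gm i m) <= mu (gm i n) + d / 4 * 2^-1 ^+ i.+1.
  apply: (bounded_monotone_tail (C := 1)) => [m n|n|]; first exact: mu_gm.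
    by apply: mu_const => // s; have /andP[] := gm01 i n s.
  by rewrite mulr_gt0 ?divr_gt0 ?exprn_gt0 ?invr_gt0.
exists M => n.
pose fix hm n : S -> R := if n is n'.+1 then hm n' \min gm n (M n) else gm 0 (M 0).
have hm01 i : unit_valued (hm i) by elim: i => [|i IHi] /=; [exact: gm01|exact: u_min].
have hm_le i s j : (j <= i)%N -> hm i s <= gm j (M j) s.
  elim: i => [|i IHi]; first by rewrite leqn0 => /eqP ->.
  rewrite leq_eqVlt => /predU1P[->|]; first by rewrite /= ge_min lexx orbT.
  by rewrite ltnS => /IHi le1; rewrite /= ge_min le1.
have mu_hm i : mu (gm i (M i)) - d / 4 * \sum_(j < i) 2^-1 ^+ j.+1 <= mu (hm i).
  elim: i => [|i IHi]; first by rewrite big_ord0 mulr0 subr0.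
  have := mu_mod (hm i) (gm i.+1 (M i.+1)) (hm01 i) (gm01 _ _); rewrite big_ord_recr/= mulrDr.
  have : mu (hm i \max gm i.+1 (M i.+1)) <= mu (gm i (M i)) + d / 4 * 2^-1 ^+ i.+1.
    apply: le_trans (MP i (maxn (M i) (M i.+1).+1)); apply: mu_le => //; first exact: u_max.
    move=> s /=; rewrite ge_max; apply/andP; split.
      by apply: le_trans (hm_le i s i (leqnn _)) _; apply: gm_mono; exact: leq_maxl.
    have [j /andP[ij jM] ->] := gm_ex i.+1 s (M i.+1).
    apply: gm_ge; rewrite ltnW//=; apply: leq_trans jM _.
    by rewrite addSnnS leq_add2l leq_maxr.
  by move: IHi; lra.
have hm_ge : d / 2 <= mu (hm n).
  have le1 : d <= mu (gm n (M n)).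
    apply: le_trans (fd n) _; apply: mu_le => // s; apply: gm_ge.
    by rewrite leqnn leq_addr.
  have le2 : d / 4 * \sum_(j < n) 2^-1 ^+ j.+1 <= d / 4.
    by rewrite ler_piMr ?sum_half_pow// divr_ge0// ltW.
  by have := mu_hm n; lra.
have [s hs] : exists s, d / 4 <= hm n s.
  apply: contrapT => nos; have : mu (hm n) <= d / 4.
    apply: mu_const => // s; rewrite leNgt; apply/negP => lt; apply: nos.
    by exists s; exact: ltW.
  by lra.
exists s => i ni; have [j jP jE] := gm_ex i s (M i); exists j => //.
by rewrite -jE; apply: le_trans hs _; exact: hm_le.
Qed.

End Averages.

(** * Weakly null elementary tensors *)

(** The finite averages of [approach_mean] have a limit along [U], a mean for
    which every [f i] is at least [d / 2]. The points given by
    [bounded_convergence] accumulate at a point where the [f i] do not tend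
    to 0. *)
Lemma no_lower_bounded_averages (R : realType) (S : Type) (f : nat -> S -> R) (d : R)
    (U : set_system nat) (UU : UltraFilter U) :
  \oo `<=` U -> 0 < d -> d <= 1 -> (forall i, unit_valued (f i)) ->
  (forall s, (fun i => f i s) @ \oo --> 0) ->
  (forall sigma : nat -> S, exists s, forall j, (fun n => f j (sigma n)) @ U --> f j s) ->
  (forall m (c : nat -> R), (forall i, 0 <= c i) ->
    exists s, d * \sum_(i < m) c i <= \sum_(i < m) c i * f i s) -> False.
Proof.
move=> UE d0 d1 f01 f_null f_cpt fd.
have UP : ProperFilter U by exact: ultra_proper.
have [p pP] := choice (fun m => approach_mean d0 d1 f01 (fd m)).
have p_le1 (g : S -> R) m : unit_valued g -> `|mean (p m) g| <= 1.
  move=> g01; rewrite ger0_norm.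
    rewrite -[leRHS](mean_const 1 (pP m).1); apply: mean_le => s.
    by have /andP[] := g01 s.
  rewrite -[leLHS](mean_const 0 (pP m).1); apply: mean_le => s.
  by have /andP[] := g01 s.
have /choice[mu muP] g : exists l : R, unit_valued g ->
    (fun m => mean (p m) g) @ U --> l.
  have [g01|ng] := pselect (unit_valued g); last by exists 0.
  have [|l lP] := @ultra_real_cvg R _ U UU (fun m => mean (p m) g) 1.
    by apply: filterE => m; exact: p_le1.
  by exists l.
have d20 : 0 < d / 2 by rewrite divr_gt0.
have [|||i|M MP] := @bounded_convergence R S mu f (d / 2) d20 _ _ _ f01.
- move=> g h g01 h01 gh; apply: ler_cvg_to (muP _ g01) (muP _ h01) _.
  by apply: filterE => m; exact: mean_le.
- move=> g h g01 h01.
  have min01 : unit_valued (g \min h).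
    move=> s /=; have /andP[a b] := g01 s; have /andP[a' b'] := h01 s.
    by rewrite le_min a a'/= ge_min b.
  have max01 : unit_valued (g \max h).
    move=> s /=; have /andP[a b] := g01 s; have /andP[a' b'] := h01 s.
    by rewrite le_max a/= ge_max b b'.
  have c1 : (fun m => mean (p m) g + mean (p m) h) @ U --> mu g + mu h.
    by apply: cvgD; exact: muP.
  have c2 : (fun m => mean (p m) (g \min h) + mean (p m) (g \max h)) @ U -->
      mu (g \min h) + mu (g \max h) by apply: cvgD; exact: muP.
  apply: (cvg_unique (@norm_hausdorff _ R^o)) c2 _; apply: cvg_trans c1.
  apply: near_eq_cvg; apply: filterE => m; rewrite -[LHS]meanD -[RHS]meanD.
  by congr mean; apply/funext => s; rewrite /= addr_min_max.
- move=> g c g01 gc; apply: (cvgr_to_le (muP _ g01)); apply: filterE => m.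
  by rewrite -[leRHS](mean_const c (pP m).1); exact: mean_le.
- apply: (cvgr_to_ge (muP _ (f01 i))); apply: UE; exists i.+1 => // m /= im.
  exact: (pP m).2.
have [sigma sP] := choice MP; have [s fs] := f_cpt sigma.
have d80 : 0 < d / 2 / 4 / 2 by rewrite !divr_gt0.
move/cvgrPdist_lt: (f_null s) => /(_ _ d80)[i _ iP].
have : U (fun n => forall j, (i <= j < (i + M i).+1)%N -> `|f j s - f j (sigma n)| < d / 2 / 4 / 2).
  have UI : \forall n \near U, forall j : 'I_(i + M i).+1, `|f j s - f j (sigma n)| < d / 2 / 4 / 2.
    apply: filter_forall => j; move/cvgrPdist_lt: (fs j); exact.
  by apply: filterS UI => n nP j /andP[_ jM]; exact: (nP (Ordinal jM)).
have Ui : U [set n | (i <= n)%N] by apply: UE; exists i.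
move=> Uf; have [n [/= i_le_n nP]] := filter_ex (filterI Ui Uf).
have [j /andP[ij jM] fj] := sP n i i_le_n.
have := nP j; rewrite ij ltnS jM => /(_ isT); have := iP j ij.
rewrite /= sub0r normrN ger0_norm; last by have /andP[] := f01 j s.
by move=> lt1 /ltr_normlP[]; lra.
Qed.

Lemma not_null_subseq (R : realType) (u : nat -> R) : (forall n, 0 <= u n) ->
  ~ (u @ \oo --> 0) -> exists (e : R) (n : nat -> nat),
    0 < e /\ forall i, (i <= n i)%N /\ e <= u (n i).
Proof.
move=> u0 nu; apply: contrapT => nP; apply: nu; apply/cvgrPdist_lt => e e0.
apply: contrapT => nN; apply: nP; exists e.
have /choice[n nP] i : exists n, (i <= n)%N /\ e <= u n.
  apply: contrapT => ni; apply: nN; exists i => // n /= i_le_n.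
  rewrite sub0r normrN ger0_norm// ltNge; apply/negP => en; apply: ni.
  by exists n.
by exists n.
Qed.

Lemma subseq_cvg (T : topologicalType) (u : nat -> T) (l : T) (n : nat -> nat) :
  (forall i, (i <= n i)%N) -> u @ \oo --> l -> (u \o n) @ \oo --> l.
Proof.
move=> ni ul A /ul[N _ NA]; exists N => // i /= Ni; apply: NA => /=.
exact: leq_trans Ni (ni i).
Qed.

Section Tensors.
Variables (R : realType) (k : scalar_kind).
Local Notation K := (scalars R k).
Variables E F : normedModType K.
Local Notation X := (injective_tensor E F).

Lemma modulus_tensor_ub (f : X) p : modulus (val f p) <= modulus f.
Proof.
rewrite -(ler_of_real k) -!modulusE; exact: ler_injective_norm.
Qed.

Lemma modulus_tensor_le (f : X) c : (forall p, modulus (val f p) <= c) -> modulus f <= c.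
Proof.
move=> fc; rewrite -(ler_of_real k) -modulusE; apply: injective_norm_le => p.
by rewrite norm_le_modulus.
Qed.

Lemma tensor_form_in (u : seq (E * F)) : tensor_form u \in @injective_tensor_pred K E F.
Proof.
apply/asboolP => e e0; exists u => p; rewrite subrr normr0; exact: ltW.
Qed.

Definition tensor (x : E) (y : F) : X := InjectiveTensor (tensor_form_in [:: (x, y)]).

Lemma tensorE x y p : val (tensor x y) p = sval p.1 x * sval p.2 y.
Proof. by rewrite /= /tensor_form big_seq1. Qed.

Lemma val_sum_scale (n : nat) (a : 'I_n -> K) (u : 'I_n -> X) p :
  val (\sum_i a i *: u i) p = \sum_i a i * val (u i) p.
Proof. exact: (big_morph (fun f : X => val f p) (id1 := 0) (op1 := +%R)). Qed.

Lemma tensorZ x y a : tensor x (a *: y) = a *: tensor x y.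
Proof.
apply: val_inj; apply/funext => p; rewrite tensorE.
rewrite [RHS](_ : _ = a * val (tensor x y) p)// tensorE linearZ/=.
by rewrite mulrCA.
Qed.

Lemma modulus_tensor x y : modulus (tensor x y) <= modulus x * modulus y.
Proof.
apply: modulus_tensor_le => p; rewrite tensorE modulusM.
by apply: ler_pM; rewrite ?modulus_ge0 ?modulus_dual_ball.
Qed.

Lemma dual_ball_compact (U : set_system nat) (UU : UltraFilter U) (sigma : nat -> dual_ball E) :
  exists s : dual_ball E, forall x, (fun n => sval (sigma n) x : K^o) @ U --> sval s x.
Proof.
have [||phi [phi1 phiP]] := @ultralimit_functional R k _ U UU E (fun n => sval (sigma n)) 1.
- by move=> x; apply: filterE => n; rewrite mul1r modulus_dual_ball.
- by move=> a x y; apply: filterE => n; rewrite linearP.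
have [|s sE] := @in_dual_ball R k E phi; first by move=> x; rewrite -[leRHS]mul1r.
by exists s => x; rewrite sE; exact: phiP.
Qed.

(** Otherwise, after rotating the [y n], a functional bounded by [C] is at least
    [e] along a subsequence of the tensors. A convex combination with
    coefficients [c i] has norm at least [e / C], and at most the supremum over the
    dual ball of the same combination of the functions [|q (x i)|]. These
    functions are pointwise null. *)
Lemma tensor_weakly_null (x : nat -> E) (y : nat -> F) (Phi : dual X) :
  (forall n, modulus (x n) <= 1) -> (forall n, modulus (y n) <= 1) ->
  (forall q : dual_ball E, (fun n => sval q (x n)) @ \oo --> (0 : K^o)) ->
  (fun n => sval Phi (tensor (x n) (y n))) @ \oo --> (0 : K^o).
Proof.
case: Phi => Phi /= /continuous_linear_bound[C C0 PhiC] x1 y1 x_null.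
apply: contrapT => nPhi.
have [||e [n [e0 nP]]] := @not_null_subseq R (fun n => modulus (Phi (tensor (x n) (y n)))).
- by move=> n; exact: modulus_ge0.
- move=> mPhi; apply: nPhi; apply/cvg_modulus => e e0.
  move/cvgrPdist_lt: mPhi => /(_ _ e0); apply: filterS => i.
  by rewrite !sub0r !normrN modulusN ger0_norm ?modulus_ge0.
pose x' i := x (n i).
pose y' i := phase (Phi (tensor (x (n i)) (y (n i)))) *: y (n i).
have y'1 i : modulus (y' i) <= 1 by rewrite modulusZ modulus_phase mul1r.
have Phi_xy i : Phi (tensor (x' i) (y' i)) = of_real k (modulus (Phi (tensor (x (n i)) (y (n i))))).
  by rewrite tensorZ linearZ/= [LHS]phaseM.
have [U [UU UE]] := ultraFilterLemma (eventually_filter).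
pose d := Num.min 1 (e / (2 * C)).
have d0 : 0 < d by rewrite lt_min ltr01 divr_gt0// mulr_gt0.
apply: (@no_lower_bounded_averages R (dual_ball E)
  (fun i q => modulus (sval q (x' i))) d U UU UE d0).
- by rewrite ge_min lexx.
- move=> i q; rewrite modulus_ge0/=; apply: le_trans (modulus_dual_ball _ _) _; exact: x1.
- move=> q; rewrite -(@modulus0 R k K); apply: modulus_cvg.
  exact: subseq_cvg (fun i => (nP i).1) (x_null q).
- move=> sigma; have [s sP] := dual_ball_compact UU sigma; exists s => j.
  exact: modulus_cvg (sP _).
move=> m c c0; apply: contrapT => nos.
have small (q : dual_ball E) : \sum_(i < m) c i * modulus (sval q (x' i)) < d * \sum_(i < m) c i.
  by rewrite ltNge; apply/negP => le1; apply: nos; exists q.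
have c_ge0 : 0 <= \sum_(i < m) c i by apply: sumr_ge0.
pose u := \sum_(i < m) of_real k (c i) *: tensor (x' i) (y' i).
have u_le : modulus u <= d * \sum_(i < m) c i.
  apply: modulus_tensor_le => p; rewrite val_sum_scale.
  apply: le_trans (ler_modulus_sum _ _ _) _; apply: le_trans (ltW (small p.1)).
  apply: ler_sum => i _; rewrite modulusM modulus_of_real// ler_wpM2l//.
  rewrite tensorE modulusM ler_piMr ?modulus_ge0//.
  exact: le_trans (modulus_dual_ball _ _) (y'1 i).
have Phiu : Phi u = of_real k (\sum_(i < m) c i * modulus (Phi (tensor (x (n i)) (y (n i))))).
  rewrite linear_sum rmorph_sum; apply: eq_bigr => i _.
  by rewrite linearZ/= Phi_xy rmorphM.
have le1 : e * \sum_(i < m) c i <= modulus (Phi u).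
  rewrite Phiu modulus_of_real; last first.
    by apply: sumr_ge0 => i _; rewrite mulr_ge0 ?modulus_ge0.
  by rewrite mulr_sumr; apply: ler_sum => i _; rewrite mulrC ler_wpM2l// (nP i).2.
have le2 : modulus (Phi u) <= e / 2 * \sum_(i < m) c i.
  apply: le_trans (PhiC _) _; apply: le_trans (ler_wpM2l (ltW C0) u_le) _.
  rewrite mulrA ler_wpM2r//; apply: le_trans (_ : C * (e / (2 * C)) <= _).
    by rewrite ler_wpM2l ?(ltW C0)// ge_min lexx orbT.
  by rewrite le_eqVlt; apply/orP; left; apply/eqP; field; rewrite gt_eqF.
have sum0 : \sum_(i < m) c i = 0 by apply/eqP; rewrite eq_le c_ge0 andbT; nra.
have := small (dual_ball0 E); rewrite sum0 mulr0; apply/negP; rewrite -leNgt.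
by apply: sumr_ge0 => i _; rewrite mulr_ge0 ?modulus_ge0.
Qed.

End Tensors.

(** * Square summability of tensors *)

Section SquareSummable.
Variables (R : realType) (k : scalar_kind).
Local Notation K := (scalars R k).
Variables (E F : normedModType K) (L : R).
Hypothesis L1 : 1 <= L.
Hypothesis charts : forall t : seq E, exists c : ell1_chart E L,
  {subset t <= chart_dom c}.
Variables (r : nat -> dual_ball E) (q : nat -> dual_ball F).
Hypothesis q_wuc : forall N y, \sum_(n < N) modulus (sval (q n) y) <= modulus y.

Lemma signed_sum_ball (e : nat -> bool) N : exists p : dual_ball F,
  forall y, sval p y = \sum_(n < N) (-1) ^+ e n * sval (q n) y.
Proof.
pose f y : K^o := \sum_(n < N) (-1) ^+ e n * sval (q n) y.
have flin : linear f.
  move=> a x y; rewrite /f scaler_sumr -big_split/=; apply: eq_bigr => n _.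
  by rewrite linearP/= mulrDr mulrCA.
pose f' : {linear F -> K^o} := HB.pack f (GRing.isLinear.Build _ _ _ _ f flin).
apply: (@in_dual_ball R k F f') => y; apply: le_trans (q_wuc N y).
apply: le_trans (ler_modulus_sum _ _ _) _; apply: ler_sum => n _.
by rewrite modulusM; case: (e n); rewrite ?expr0 ?expr1 ?modulusN modulus1 mul1r.
Qed.

(** Slicing [u] by [q n] gives vectors [a n] of [E]. A signed sum of the [a n] is
    the slice of [u] by the signed sum of the [q n], which is in the dual ball; so
    it has norm at most [L B], and cotype 2 applies in a chart. *)
Lemma tensor_form_square_sum (u : seq (E * F)) (B : R) :
  (forall p, modulus (tensor_form u p) <= B) ->
  forall N, \sum_(n < N) modulus (tensor_form u (r n, q n)) ^+ 2 <= 4 * (L ^+ 2 * B) ^+ 2.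
Proof.
move=> uB N; have L0 : 0 < L by rewrite (lt_le_trans ltr01).
pose a n : E := \sum_(z <- u) sval (q n) z.2 *: z.1.
have formE (p : dual_ball E) n : tensor_form u (p, q n) = sval p (a n).
  rewrite /tensor_form linear_sum/=; apply: eq_bigr => z _.
  by rewrite linearZ/= mulrC.
pose b e : E := \sum_(n < N) (-1) ^+ e n *: a n.
have b_le (e : nat -> bool) : modulus (b e) <= L * B.
  have [p bp] := script_L1_norming L1 charts (b e).
  apply: le_trans bp _; rewrite ler_wpM2l ?(ltW L0)//.
  have [qe qeE] := signed_sum_ball e N.
  rewrite (_ : sval p (b e) = tensor_form u (p, qe)) ?uB//.
  rewrite /b linear_sum /tensor_form/=.
  under [RHS]eq_bigr do rewrite qeE mulr_sumr.
  rewrite exchange_big/=; apply: eq_bigr => n _.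
  rewrite linearZ/= -formE /tensor_form [LHS]mulr_sumr; apply: eq_bigr => z _ /=.
  by rewrite mulrCA.
have [c cP] := charts [seq a n | n <- iota 0 N].
have ac (n : 'I_N) : a n \in chart_dom c by apply: cP; rewrite map_f// mem_iota/=.
pose s := [seq chart_coord c (a n) | n <- iota 0 N].
have avg_le : sign_avg s (@l1 R k _) 0 <= L ^+ 2 * B.
  apply: (@sign_avg_bound R K) => e; rewrite add0r.
  have -> : \sum_(i < size s) (-1) ^+ e i *: s`_i = chart_coord c (b e).
    rewrite chart_coord_sum// -(big_mkord xpredT (fun i => (-1) ^+ e i *: s`_i)).
    rewrite size_map size_iota big_mkord; apply: eq_bigr => i _.
    by rewrite (nth_map 0%N) ?size_iota// nth_iota.
  have bc : b e \in chart_dom c by apply: rpred_sum => i _; exact: rpredZ.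
  apply: le_trans (chart_coord_le bc) _.
  by rewrite expr2 -mulrA ler_wpM2l ?(ltW L0)// b_le.
have avg_ge0 : 0 <= sign_avg s (@l1 R k _) 0.
  rewrite -[leLHS](sign_avg_const s 0 0); apply: sign_avg_le => v.
  by apply: sumr_ge0 => j _; exact: modulus_ge0.
apply: le_trans (_ : \sum_(v <- s) l1 v ^+ 2 <= _).
  have iotaE (g : nat -> R) : \sum_(n <- iota 0 N) g n = \sum_(n < N) g n.
    by rewrite -(big_mkord xpredT g) /index_iota subn0.
  rewrite big_map iotaE.
  apply: ler_sum => n _; rewrite ler_sqr ?nnegrE ?modulus_ge0//; last first.
    by apply: sumr_ge0 => j _; exact: modulus_ge0.
  rewrite formE; apply: le_trans (modulus_dual_ball _ _) _; exact: chart_coord_ge.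
apply: le_trans (l1_cotype2 s) _; rewrite ler_wpM2l// ler_sqr ?nnegrE//.
exact: le_trans avg_le.
Qed.

(** A finite sum of tensors that approximates [f] to within [1 / (N + 1)] has norm
    at most 2, and the accumulated error over [N] terms is at most 2. *)
Lemma injective_tensor_square_sum (f : injective_tensor E F) : modulus f <= 1 ->
  forall N, \sum_(n < N) modulus (val f (r n, q n)) ^+ 2 <= 32 * L ^+ 4 + 2.
Proof.
move=> f1 N; have L0 : 0 < L by rewrite (lt_le_trans ltr01).
pose h : R := (N.+1%:R)^-1.
have h0 : 0 < h by rewrite invr_gt0 ltr0n.
have h1 : h <= 1 by rewrite invf_le1 ?ltr0n// ler1n.
have /injective_tensor_predP/(_ (of_real k h)) := valP f.
rewrite -(rmorph0 (@of_real R k)) ltr_of_real => /(_ h0)[u uP].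
have uh p : modulus (val f p - tensor_form u p) <= h.
  by rewrite -(ler_of_real k) -modulusE.
have uB p : modulus (tensor_form u p) <= 2.
  rewrite -(subrK (val f p) (tensor_form u p)) addrC.
  apply: le_trans (ler_modulusD _ _) _; rewrite [2]/(1 + 1); apply: lerD.
    by apply: le_trans (modulus_tensor_ub _ _) _.
  by rewrite modulusBC (le_trans (uh p)).
have := tensor_form_square_sum uB N => sum_le.
apply: le_trans (_ : \sum_(n < N)
    (2 * modulus (tensor_form u (r n, q n)) ^+ 2 + 2 * h ^+ 2) <= _).
  apply: ler_sum => n _; set p := (_, _).
  have le1 : modulus (val f p) <= modulus (tensor_form u p) + h.
    rewrite -(subrK (tensor_form u p) (val f p)) addrC.
    by apply: le_trans (ler_modulusD _ _) _; rewrite lerD2l uh.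
  have le2 : modulus (val f p) ^+ 2 <= (modulus (tensor_form u p) + h) ^+ 2.
    by rewrite ler_sqr ?nnegrE ?modulus_ge0// addr_ge0 ?modulus_ge0// ltW.
  apply: le_trans le2 _; rewrite -subr_ge0.
  by rewrite (_ : _ - _ = (modulus (tensor_form u p) - h) ^+ 2) ?sqr_ge0//; ring.
rewrite big_split/= -mulr_sumr sumr_const card_ord; apply: lerD.
  by move: sum_le; rewrite (_ : 4 * _ = 16 * L ^+ 4); [lra|ring].
rewrite -[_ *+ N]mulr_natr -mulrA ler_piMr// expr2 -mulrA.
have le1 : h * N%:R <= 1 by rewrite mulrC ler_pdivrMr ?ltr0n// mul1r ler_nat.
by apply: le_trans (_ : h * 1 <= _); [rewrite ler_wpM2l// ltW|rewrite mulr1].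
Qed.

Lemma square_sum_operator : exists T : {linear injective_tensor E F -> bounded_seq R k},
  [/\ continuous T, exists C, forall f, modulus f <= 1 -> l2_ball C (T f) &
      forall f n, val (T f) n = val f (r n, q n)].
Proof.
have inT (f : injective_tensor E F) : (fun n => val f (r n, q n)) \in @bounded_seq_pred R k.
  by apply/asboolP; exists (modulus f) => n; exact: modulus_tensor_ub.
pose T f := BoundedSeq (inT f).
have Tlin : linear T by move=> a f g; apply: val_inj.
pose T' : {linear injective_tensor E F -> bounded_seq R k} :=
  HB.pack T (GRing.isLinear.Build _ _ _ _ T Tlin).
exists T'; split=> //.
  apply: (@modulus_bounded_continuous _ _ _ _ T' 1) => f; rewrite mul1r.
  by apply: modulus_bounded_seq_le => n; exact: modulus_tensor_ub.
by exists (32 * L ^+ 4 + 2) => f; exact: injective_tensor_square_sum.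
Qed.

End SquareSummable.

(** * The Schur and Dunford-Pettis properties *)

Section SchurProperty.
Variables (R : realType) (k : scalar_kind).
Local Notation K := (scalars R k).
Implicit Types E F : normedModType K.

Lemma weak_cvg_ballP E (x : nat -> E) (l : E) :
  (x : nat -> weak E) @ \oo --> (l : weak E) <->
  forall q : dual_ball E, (fun n => sval q (x n - l)) @ \oo --> (0 : K^o).
Proof.
rewrite weak_cvgP; split=> [xl q|xl phi].
  have [phi phiE] := dual_of_ball q; rewrite -phiE.
  apply/cvg_modulus => e e0; move/cvg_modulus: (xl phi) => /(_ _ e0).
  by apply: filterS => n; rewrite linearB sub0r modulusN modulusBC.
have [a [q qE]] := dual_scaled_ball phi.
have c : (fun n => a *: (sval q (x n - l) : K^o) + sval phi l) @ \oo -->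
    a *: (0 : K^o) + sval phi l.
  by apply: cvgD; [apply: cvgZl_tmp; exact: xl|exact: cvg_cst].
rewrite scaler0 add0r in c; apply: cvg_trans c; apply: near_eq_cvg; apply: filterE => n.
by rewrite !qE linearB [_ *: _]mulrBr subrK.
Qed.

(** Interleave the sequence with 0: the norm limit is then 0. *)
Lemma schur_null E (x : nat -> E) : schur E ->
  (forall q : dual_ball E, (fun n => sval q (x n)) @ \oo --> (0 : K^o)) ->
  x @ \oo --> (0 : E).
Proof.
move=> schurE xq; pose v n := if odd n then 0 else x n./2.
have /schurE/cvg_ex[g vg] : (v : nat -> weak E) @ \oo --> (0 : weak E).
  apply/weak_cvg_ballP => q; apply/cvg_modulus => e e0.
  move/cvg_modulus: (xq q) => /(_ _ e0)[N _ NP]; exists N.*2 => // n /= Nn.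
  rewrite sub0r modulusN subr0 /v; case: (odd n); first by rewrite linear0 modulus0.
  have := NP n./2; rewrite /= sub0r modulusN; apply.
  by rewrite -(doubleK N) half_leq.
have g0 : g = 0.
  apply: (cvg_unique (@norm_hausdorff _ _)) (subseq_cvg (n := fun n => n.*2.+1) _ vg) _.
    by move=> i; rewrite -addnn leqW// leq_addr.
  rewrite (_ : v \o _ = fun=> 0); first exact: cvg_cst.
  by apply/funext => n; rewrite /= /v /= odd_double.
rewrite -g0; have := subseq_cvg (n := fun n => n.*2) _ vg.
rewrite (_ : v \o _ = x); last by apply/funext => n; rewrite /= /v odd_double doubleK.
by apply=> i; rewrite -addnn leq_addr.
Qed.

(** If the images are not norm Cauchy, some differences of terms with large indices
    stay away from 0; but they are weakly null. *)
Lemma schur_dunford_pettis E : schur E -> dunford_pettis E.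
Proof.
move=> schurE F T Tc _ x xc.
have [C C0 TC] := continuous_linear_bound Tc.
apply/cauchy_modulus => e e0; apply: contrapT => nTx.
have /choice[mn mnP] i : exists mn : nat * nat,
    [/\ (i <= mn.1)%N, (i <= mn.2)%N & e <= modulus (T (x mn.1 - x mn.2))].
  apply: contrapT => ni; apply: nTx; exists (T (x i)); exists i => // j /= ij.
  rewrite ltNge; apply/negP => le1; apply: ni; exists (i, j).
  by rewrite leqnn ij linearB.
have d0 : (fun i => x (mn i).1 - x (mn i).2) @ \oo --> (0 : E).
  apply: schur_null => // q; have [phi phiE] := dual_of_ball q; rewrite -phiE.
  apply/cvg_modulus => h h0.
  have h20 : 0 < h / 2 by rewrite divr_gt0.
  have /cauchy_modulus/(_ _ h20)[a [N _ NP]] := weak_cauchy xc phi.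
  exists N => // i /= Ni; have [im in' _] := mnP i.
  have lt1 := NP _ (leq_trans Ni im); have lt2 := NP _ (leq_trans Ni in').
  rewrite sub0r modulusN linearB; apply: le_lt_trans (ler_modulusBD _ a _) _.
  by rewrite modulusBC (splitr h) ltrD.
have eC0 : 0 < e / C by rewrite divr_gt0.
move/cvg_modulus: d0 => /(_ _ eC0)[N _ /(_ N (leqnn N))].
rewrite sub0r modulusN ltr_pdivlMr// => lt1.
have [_ _ le1] := mnP N; have := le_trans le1 (TC _).
by rewrite mulrC leNgt lt1.
Qed.

End SchurProperty.

Section Swap.
Variables (R : realType) (k : scalar_kind).
Local Notation K := (scalars R k).
Variables E F : normedModType K.

Lemma swap_in (f : injective_tensor E F) :
  (fun p => val f (p.2, p.1)) \in @injective_tensor_pred K F E.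
Proof.
apply/asboolP => e e0; have /injective_tensor_predP/(_ e e0)[u uP] := valP f.
exists [seq (z.2, z.1) | z <- u] => p.
rewrite (_ : tensor_form _ p = tensor_form u (p.2, p.1)); first exact: uP.
by rewrite /tensor_form big_map; apply: eq_bigr => z _; rewrite mulrC.
Qed.

Definition swap (f : injective_tensor E F) : injective_tensor F E :=
  InjectiveTensor (swap_in f).

Lemma swap_is_linear : linear swap.
Proof. by move=> a f g; apply: val_inj. Qed.

HB.instance Definition _ := GRing.isLinear.Build K (injective_tensor E F)
  (injective_tensor F E) _ swap swap_is_linear.

Lemma modulus_swap f : modulus (swap f) <= modulus f.
Proof. by apply: modulus_tensor_le => p; exact: (modulus_tensor_ub f (p.2, p.1)). Qed.

End Swap.

Section L2Operators.
Variables (R : realType) (k : scalar_kind).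
Local Notation K := (scalars R k).
Implicit Types E F : normedModType K.

Lemma swapK E F : cancel (@swap R k E F) (@swap R k F E).
Proof. by move=> f; apply: val_inj; apply/funext => -[]. Qed.

(** The consequence of the Dunford-Pettis property that is contradicted below.
    Unlike the property itself, it involves a single target space, and it passes
    through the exchange of the two factors by composition. *)
Definition l2_null E := forall (T : {linear E -> bounded_seq R k}) (C : R) (w : nat -> E),
  continuous T -> (forall x, modulus x <= 1 -> l2_ball C (T x)) ->
  (forall phi : dual E, (fun n => sval phi (w n)) @ \oo --> (0 : K^o)) ->
  (T \o w) @ \oo --> (0 : bounded_seq R k).

(** The images are norm Cauchy, and the coordinates of their limit are 0 because
    they are weakly continuous. *)
Lemma dunford_pettis_l2_null E : dunford_pettis E -> l2_null E.
Proof.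
move=> DP T C w Tc TC wnull.
have /cauchy_cvg/cvg_ex[g Tg] : cauchy ((T \o w) @ \oo).
  apply: (DP _ T Tc (l2_weakly_compact TC)); apply: cvg_cauchy.
  apply/cvg_ex; exists (0 : weak E); apply/weak_cvgP => phi.
  by rewrite linear0; exact: wnull.
suff g0 : g = 0 by rewrite -g0.
apply: val_inj; apply/funext => n.
have [phi phiE] := coordinate_functional R k n.
have [D D0 TD] := continuous_linear_bound Tc.
have [C' C'0 phiC] := continuous_linear_bound (svalP phi).
have [psi psiE] : exists psi : dual E, forall x, sval psi x = sval phi (T x).
  apply: (@bounded_functional _ _ _ (sval phi \o T) (C' * D)) => [a x y|x] /=.
    by rewrite !linearP.
  by apply: le_trans (phiC _) _; rewrite -mulrA ler_wpM2l// ltW.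
have c1 : (fun i => sval phi (T (w i))) @ \oo --> (0 : K^o).
  by have := wnull psi; under eq_fun do rewrite psiE.
have c2 : (fun i => sval phi (T (w i))) @ \oo --> sval phi g.
  exact: (cvg_comp (T \o w) (sval phi) Tg (svalP phi g)).
by rewrite -phiE; exact: (cvg_unique (@norm_hausdorff _ _) c2 c1).
Qed.

Lemma l2_null_swap E F : l2_null (injective_tensor E F) -> l2_null (injective_tensor F E).
Proof.
move=> EF T C w Tc TC wnull.
pose S : {linear injective_tensor E F -> bounded_seq R k} := T \o @swap R k E F.
have -> : T \o w = S \o (@swap R k F E \o w).
  by apply/funext => n; rewrite /= swapK.
have [D D0 TD] := continuous_linear_bound Tc.
apply: (EF S C).
- apply: (@modulus_bounded_continuous _ _ _ _ S D) => f; apply: le_trans (TD _) _.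
  by rewrite ler_wpM2l ?(ltW D0)// modulus_swap.
- by move=> f f1; apply: TC; apply: le_trans (modulus_swap _) f1.
move=> phi; have [C' C'0 phiC] := continuous_linear_bound (svalP phi).
have [psi psiE] : exists psi : dual (injective_tensor F E),
    forall f, sval psi f = sval phi (@swap R k F E f).
  apply: (@bounded_functional _ _ _ (sval phi \o @swap R k F E) C') => [a x y|x] /=.
    by rewrite !linearP.
  by apply: le_trans (phiC _) _; rewrite ler_wpM2l ?(ltW C'0)// modulus_swap.
by have := wnull psi; under eq_fun do rewrite psiE.
Qed.

(** Extract a subsequence away from the weak limit and normalize it. *)
Lemma not_schur_sequence E : ~ schur E -> exists z : nat -> E,
  (forall n, modulus (z n) = 1) /\
  forall q : dual_ball E, (fun n => sval q (z n)) @ \oo --> (0 : K^o).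
Proof.
move=> nS; have [x [l [xl nx]]] : exists (x : nat -> E) (l : E),
    (x : nat -> weak E) @ \oo --> (l : weak E) /\ ~ cvgn x.
  apply: contrapT => nxl; apply: nS => x l xl; apply: contrapT => nx.
  by apply: nxl; exists x, l.
have [||e [n [e0 nP]]] := @not_null_subseq R (fun n => modulus (x n - l)).
- by move=> n; exact: modulus_ge0.
- move=> xl0; apply: nx; apply/cvg_ex; exists l; apply/cvg_modulus => e e0.
  move/cvgrPdist_lt: xl0 => /(_ _ e0); apply: filterS => i.
  by rewrite sub0r normrN ger0_norm ?modulus_ge0// modulusBC.
have m0 i : 0 < modulus (x (n i) - l) by apply: lt_le_trans (nP i).2.
exists (fun i => (of_real k (modulus (x (n i) - l)))^-1 *: (x (n i) - l)); split.
  by move=> i; rewrite modulusZ modulus_inv modulus_of_real ?modulus_ge0// mulVf// gt_eqF.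
move=> q; apply/cvg_modulus => h h0.
have he0 : 0 < h * e by rewrite mulr_gt0.
move/weak_cvg_ballP: xl => /(_ q)/cvg_modulus/(_ _ he0)[N _ NP].
exists N => // i /= Ni; have := NP _ (leq_trans Ni (nP i).1) => /=.
rewrite !sub0r !modulusN linearZ/= modulusZ modulus_inv modulus_of_real ?modulus_ge0//.
rewrite ltr_pdivrMl// mulrC => lt1; apply: lt_le_trans lt1 _.
by rewrite ler_wpM2r ?(ltW h0)// (nP i).2.
Qed.

(** The [N]-th coordinate of the image of the [N]-th tensor is
    [r N (z N) * q N (y N)], which is bounded away from 0. *)
Lemma l2_null_schur E F : script_L1_space E -> script_L1_space F ->
  ~ finite_dimensional F -> l2_null (injective_tensor E F) -> schur E.
Proof.
move=> EL1 FL1 Finf EF; apply: contrapT => /not_schur_sequence[z [z1 znull]].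
have [L L1 charts] := script_L1_charts EL1.
have L0 : 0 < L by rewrite (lt_le_trans ltr01).
have [r rP] := choice (fun n => script_L1_norming L1 charts (z n)).
have [d [y [q [d0 y1 qy qsum]]]] := script_L1_wuc FL1 Finf.
have [T [Tc [C TC] TE]] := square_sum_operator L1 charts r qsum.
have Tw : (T \o (fun n => tensor (z n) (y n))) @ \oo --> (0 : bounded_seq R k).
  apply: (EF T C) => // phi; apply: tensor_weakly_null => // n.
  by rewrite z1.
have dL0 : 0 < L^-1 * d by rewrite mulr_gt0// invr_gt0.
move/cvg_modulus: Tw => /(_ _ dL0)[N _ /(_ N (leqnn N))].
rewrite sub0r modulusN; apply/negP; rewrite -leNgt.
apply: le_trans (modulus_bounded_seq_ub _ N); rewrite /= TE tensorE modulusM/=.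
apply: ler_pM => //; rewrite ?invr_ge0 ?(ltW L0) ?(ltW d0)//.
by have := rP N; rewrite z1 -ler_pdivrMl// mulr1.
Qed.

End L2Operators.

Section SchurTensor.
Variables (R : realType) (k : scalar_kind).
Local Notation K := (scalars R k).

Lemma ball_separates (E : normedModType K) : script_L1_space E ->
  exists2 L : R, 1 <= L & forall x, exists p : dual_ball E, modulus x <= L * modulus (sval p x).
Proof. by move=> /script_L1_charts[L L1 /(script_L1_norming L1)]; exists L. Qed.

(** Tensoring with a fixed [y <> 0] is weakly continuous and bounded below. *)
Lemma schur_tensor_left (E F : completeNormedModType K) :
  script_L1_space E -> script_L1_space F -> ~ finite_dimensional F ->
  schur (injective_tensor E F) -> schur E.
Proof.
move=> EL1 FL1 Finf EFschur x l xl.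
have [L L1 EL] := ball_separates EL1; have [M M1 FM] := ball_separates FL1.
have [y y0] : exists y : F, y != 0.
  apply: contrapT => noy; apply: Finf; exists 0%N, (fun=> 0) => x0.
  exists (fun=> 0); rewrite big_ord0; apply/eqP; apply: contrapT => /negP x00.
  by apply: noy; exists x0.
have [q qy] := FM y; pose b := modulus (sval q y).
have L0 : 0 < L by rewrite (lt_le_trans ltr01).
have b0 : 0 < b.
  rewrite lt_def modulus_ge0 andbT; apply/eqP => b0; move: qy.
  by rewrite -/b b0 mulr0 leNgt modulus_gt0 y0.
have t_ge (x1 x2 : E) : modulus (x1 - x2) <= L / b * modulus (tensor x1 y - tensor x2 y).
  have [p px] := EL (x1 - x2); apply: le_trans px _.
  rewrite -mulrA ler_wpM2l ?(ltW L0)// ler_pdivlMl//.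
  apply: le_trans (modulus_tensor_ub _ (p, q)).
  rewrite (_ : val _ _ = sval p (x1 - x2) * sval q y); first by rewrite modulusM mulrC.
  rewrite [LHS](_ : _ = val (tensor x1 y) (p, q) - val (tensor x2 y) (p, q))//.
  by rewrite !tensorE linearB; apply: esym; exact: mulrBl.
have /EFschur : ((fun n => tensor (x n) y) : nat -> weak (injective_tensor E F)) @ \oo -->
    (tensor l y : weak (injective_tensor E F)).
  apply/weak_cvgP => Phi; have [C C0 PhiC] := continuous_linear_bound (svalP Phi).
  have [phi phiE] : exists phi : dual E, forall x, sval phi x = sval Phi (tensor x y).
    apply: (@bounded_functional _ _ _ (fun x => sval Phi (tensor x y))
      (C * modulus y)) => [a x1 x2|x1].
      rewrite (_ : tensor _ y = a *: tensor x1 y + tensor x2 y) ?linearP//.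
      apply: val_inj; apply/funext => p; rewrite tensorE linearP/= mulrDl.
      rewrite -(tensorE x2 y p) -mulrA -(tensorE x1 y p).
      by [].
    apply: le_trans (PhiC _) _; rewrite -mulrA ler_wpM2l ?(ltW C0)// mulrC.
    exact: modulus_tensor.
  have : (fun n => sval phi (x n)) @ \oo --> sval phi l by exact: (proj1 (weak_cvgP _ _ _) xl).
  by rewrite phiE; under eq_fun do rewrite phiE.
move=> /cvg_cauchy/cauchy_modulus tc; apply: cauchy_cvg; apply/cauchy_modulus => e e0.
have h0 : 0 < e * b / L / 2 by rewrite !divr_gt0// mulr_gt0.
have [f [N _ NP]] := tc _ h0.
exists (x N); exists N => // n /= Nn; apply: le_lt_trans (t_ge _ _) _.
have lt1 := NP N (leqnn N); have lt2 := NP n Nn.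
rewrite mulrAC ltr_pdivrMr// mulrC -ltr_pdivlMr//.
apply: le_lt_trans (ler_modulusBD _ f _) _; rewrite modulusBC.
by rewrite [ltRHS]splitr ltrD.
Qed.

(** For a finite sum of tensors the slice is explicit. In general, slices of
    approximations of [f] form a Cauchy sequence, since the dual ball determines
    norms up to a constant. *)
Lemma slice_left (E F : completeNormedModType K) : script_L1_space E ->
  forall (f : injective_tensor E F) (q : dual_ball F), exists x : E,
    forall p : dual_ball E, sval p x = val f (p, q).
Proof.
move=> EL1 f q; have [L L1 EL] := ball_separates EL1.
have L0 : 0 < L by rewrite (lt_le_trans ltr01).
have h0 n : 0 < of_real k ((n.+1)%:R^-1 : R).
  by rewrite -(rmorph0 (@of_real R k)) ltr_of_real invr_gt0 ltr0n.
have [u uP] := choice (fun n => injective_tensor_predP _ (valP f) _ (h0 n)).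
pose s n : E := \sum_(z <- u n) sval q z.2 *: z.1.
have sE (p : dual_ball E) n : modulus (val f (p, q) - sval p (s n)) <= (n.+1)%:R^-1.
  have -> : sval p (s n) = tensor_form (u n) (p, q).
    rewrite /tensor_form linear_sum; apply: eq_bigr => z _.
    by rewrite linearZ/= mulrC.
  by rewrite -(ler_of_real k) -modulusE.
have inv_small e : 0 < e -> exists N, forall n, (N <= n)%N -> (n.+1)%:R^-1 < e :> R.
  move=> e0; exists (Num.truncn e^-1) => n Nn.
  rewrite invf_plt ?posrE ?ltr0n//; apply: lt_le_trans (truncnS_gt _) _.
  by rewrite ler_nat.
have /cauchy_cvg/cvg_ex[x sx] : cauchy (s @ \oo).
  apply/cauchy_modulus => e e0.
  have h20 : 0 < e / L / 2 by rewrite !divr_gt0.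
  have [N NP] := inv_small _ h20.
  exists (s N); exists N => // n /= Nn.
  have [p pP] := EL (s N - s n); apply: le_lt_trans pP _.
  rewrite mulrC -ltr_pdivlMr// linearB.
  apply: le_lt_trans (ler_modulusBD _ (val f (p, q)) _) _; rewrite modulusBC.
  rewrite [ltRHS]splitr; apply: ltrD; apply: le_lt_trans (sE _ _) _; exact: NP.
exists x => p.
have c1 : (fun n => sval p (s n)) @ \oo --> sval p x.
  have [phi phiE] := dual_of_ball p; rewrite -phiE.
  exact: (cvg_comp s (sval phi) sx (svalP phi x)).
have c2 : (fun n => sval p (s n)) @ \oo --> (val f (p, q) : K^o).
  apply/cvg_modulus => e /inv_small[N NP]; exists N => // n /= Nn.
  by apply: le_lt_trans (sE p n) (NP n Nn).
exact: (cvg_unique (@norm_hausdorff _ _) c1 c2).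
Qed.

Lemma slice_right (E F : completeNormedModType K) : script_L1_space F ->
  forall (f : injective_tensor E F) (p : dual_ball E), exists y : F,
    forall q : dual_ball F, sval q y = val f (p, q).
Proof.
by move=> FL1 f p; have [y yE] := slice_left FL1 (swap f) p; exists y => q; rewrite yE.
Qed.

(** Slices by functionals that nearly attain the norms reduce the claim to the
    Schur property of [E], slices by a fixed functional to that of [F]. *)
Lemma schur_tensor (E F : completeNormedModType K) :
  script_L1_space E -> script_L1_space F -> schur E -> schur F ->
  schur (injective_tensor E F).
Proof.
move=> EL1 FL1 Eschur Fschur u l ul.
pose d n := u n - l.
have dnull p : (fun n => val (d n) p) @ \oo --> (0 : K^o).
  have [phi phiE] : exists phi : dual (injective_tensor E F), forall f, sval phi f = val f p.
    apply: (@bounded_functional _ _ _ (fun f : injective_tensor E F => val f p) 1) => // f.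
    by rewrite mul1r modulus_tensor_ub.
  have cphi : (fun n => sval phi (u n)) @ \oo --> sval phi l.
    exact: (proj1 (weak_cvgP _ _ _) ul).
  apply/cvg_modulus => e e0; move/cvg_modulus: cphi => /(_ _ e0).
  apply: filterS => n; rewrite sub0r modulusN modulusBC -linearB phiE.
  exact.
have [p pP] : exists p : nat -> dual_ball E * dual_ball F,
    forall n, modulus (d n) <= 2 * modulus (val (d n) (p n)).
  have ex n : exists p, modulus (d n) <= 2 * modulus (val (d n) p).
    apply: contrapT => np; have d_le : modulus (d n) <= modulus (d n) / 2.
      apply: modulus_tensor_le => p; rewrite ler_pdivlMr// mulrC leNgt.
      by apply/negP => lt1; apply: np; exists p; exact: ltW.
    have d0 : modulus (d n) = 0 by have := modulus_ge0 (d n); lra.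
    by apply: np; exists (dual_ball0 E, dual_ball0 F); rewrite d0 mulr_ge0 ?modulus_ge0.
  by have [p pP] := choice ex; exists p.
have [x xP] := choice (fun n => slice_left EL1 (d n) (p n).2).
have xnull : x @ \oo --> (0 : E).
  apply: schur_null => // a.
  have [y yP] := choice (fun n => slice_right FL1 (d n) a).
  have ynull : y @ \oo --> (0 : F).
    by apply: schur_null => // b; under eq_fun do rewrite yP; exact: dnull.
  apply/cvg_modulus => e e0; move/cvg_modulus: ynull => /(_ _ e0).
  apply: filterS => n; rewrite !sub0r !modulusN; apply: le_lt_trans.
  by rewrite xP -yP modulus_dual_ball.
apply/cvg_ex; exists l; apply/cvg_modulus => e e0.
have e20 : 0 < e / 2 by rewrite divr_gt0.
move/cvg_modulus: xnull => /(_ _ e20); apply: filterS => n.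
rewrite sub0r modulusN ltr_pdivlMr// modulusBC; apply: le_lt_trans.
apply: le_trans (pP n) _; rewrite mulrC ler_wpM2r//.
rewrite (surjective_pairing (p n)) -xP; exact: modulus_dual_ball.
Qed.

Lemma schur_swap (E F : completeNormedModType K) :
  schur (injective_tensor E F) -> schur (injective_tensor F E).
Proof.
move=> EFschur u l ul.
have /EFschur/cvg_cauchy/cauchy_modulus uc :
    ((@swap R k F E \o u) : nat -> weak (injective_tensor E F)) @ \oo -->
    (swap l : weak (injective_tensor E F)).
  apply/weak_cvgP => phi; have [C C0 phiC] := continuous_linear_bound (svalP phi).
  have [psi psiE] : exists psi : dual (injective_tensor F E),
      forall f, sval psi f = sval phi (@swap R k F E f).
    apply: (@bounded_functional _ _ _ (sval phi \o @swap R k F E) C) => [a x y|x] /=.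
      by rewrite !linearP.
    by apply: le_trans (phiC _) _; rewrite ler_wpM2l ?(ltW C0)// modulus_swap.
  have : (fun n => sval psi (u n)) @ \oo --> sval psi l by exact: (proj1 (weak_cvgP _ _ _) ul).
  by rewrite psiE; under eq_fun do rewrite psiE.
apply: cauchy_cvg; apply/cauchy_modulus => e /uc[f uf]; exists (swap f).
case: uf => N _ NP; exists N => // n /= /NP /= lt1; apply: le_lt_trans lt1.
by rewrite -{1}(swapK (u n)) -linearB modulus_swap.
Qed.

End SchurTensor.

Theorem corollary14 (R : realType) (k : scalar_kind)
    (E F : completeNormedModType (scalars R k))
    (E_infinite : ~ finite_dimensional E) (F_infinite : ~ finite_dimensional F)
    (E_L1 : script_L1_space E) (F_L1 : script_L1_space F) :
  (dunford_pettis (injective_tensor E F) <-> schur (injective_tensor E F)) /\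
  (schur (injective_tensor E F) <-> (schur E /\ schur F)).
Proof.
have ac : dunford_pettis (injective_tensor E F) -> schur E /\ schur F.
  move=> /dunford_pettis_l2_null EF; split.
    exact: l2_null_schur E_L1 F_L1 F_infinite EF.
  exact: l2_null_schur F_L1 E_L1 E_infinite (l2_null_swap EF).
have cb : schur E /\ schur F -> schur (injective_tensor E F).
  by case; exact: schur_tensor.
split; split.
- by move=> /ac/cb.
- exact: schur_dunford_pettis.
- move=> EF; split; first exact: schur_tensor_left EF.
  exact: schur_tensor_left F_L1 E_L1 E_infinite (schur_swap EF).
- exact: cb.
Qed.
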